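(* Let $G\cong H\times K$ where $H,K$ are finite groups of coprime orders. Let $\mathbb{F}$ be a field of characteristic zero containing a primitive root of unity of order $|G|$. Let $k\ge1$ be an integer and, for a finite group $\Gamma$, let $\mathbb{F}(\Gamma)=Z(D_{\Gamma,k})$ be the center of the generic $\Gamma$-crossed product over $\mathbb{F}$. Then $\mathbb{F}(G)/\mathbb{F}$ is stably isomorphic (stably rationally equivalent) over $\mathbb{F}$ to the fraction field of $\mathbb{F}(H)\otimes_{\mathbb{F}}\mathbb{F}(K)$.
   Context: Generic crossed product. Let $G$ be a finite group, $\mathbb{F}$ a field of characteristic zero, $k\ge1$. Take indeterminates $x_{h,g}^{(i)}$ ($h,g\in G$, $1\le i\le k$) algebraically independent over $\mathbb{F}$, and index rows and columns of matrices in $M_{|G|}(\mathbb{F}(x_{h,g}^{(i)}))$ by $G$, with matrix units $E_{g,h}$. For $g\in G$, $1\le i\le k$ put $X_{g,i}=\sum_{h\in G}x^{(i)}_{h,hg}E_{h,hg}$. Let $R_{G,k}$ be the unital $\mathbb{F}$-subalgebra generated by all $X_{g,i}$ ($g\in G$, $1\le i\le k$). The generic $G$-crossed product $D_{G,k}$ is obtained from $R_{G,k}$ by inverting all its nonzero central elements; its center is denoted $\mathbb{F}(G)=Z(D_{G,k})$ and is a field extension of $\mathbb{F}$. Two finitely generated field extensions $\mathbb{L}_1,\mathbb{L}_2$ of $\mathbb{F}$ are stably isomorphic over $\mathbb{F}$ if $\mathbb{L}_1(x_1,\dots,x_a)\cong\mathbb{L}_2(y_1,\dots,y_b)$ as $\mathbb{F}$-algebras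 for some indeterminates algebraically independent over $\mathbb{L}_1$, resp. $\mathbb{L}_2$. *)

(* Defs.v *)
From HB Require Import structures.
From mathcomp Require Import all_boot all_order all_algebra all_fingroup.
From mathcomp Require Import boolp.
From mathcomp Require Import mpoly.

Set Implicit Arguments.
Unset Strict Implicit.
Unset Printing Implicit Defensive.

Import GRing.Theory.
Local Open Scope ring_scope.

(* [ratfun L n] is the rational function field L(x_0, ..., x_(n-1)). *)
Definition ratfun (L : fieldType) (n : nat) : fieldType :=
  {fraction {mpoly L[n]}}.

Definition ratfunC (L : fieldType) (n : nat) : {rmorphism L -> ratfun L n} :=
  @tofrac {mpoly L[n]} \o @mpolyC n L.

Definition ratfunX (L : fieldType) (n : nat) (i : 'I_n) : ratfun L n :=
  tofrac ('X_i : {mpoly L[n]}).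

(* Pitfall: over [ratfun], [done] on a goal [c != 0] may start computing in the
   fraction field; pass such hypotheses explicitly, or work over an abstract
   field as here. *)
Lemma addr_scaleV (L : fieldType) (n : nat) (c d : L) (r s : 'M[L]_n) :
  c != 0 -> d != 0 ->
  c^-1 *: r + d^-1 *: s = (c * d)^-1 *: (d%:M *m r + c%:M *m s).
Proof.
move=> c0 d0; rewrite !mul_scalar_mx scalerDr !scalerA invfM.
by rewrite -mulrA mulVf // mulr1 mulrAC mulVf // mul1r.
Qed.

Section GenericCrossedProduct.
Variables (F : fieldType) (gT : finGroupType) (k : nat).

Definition gcp_field : fieldType := ratfun F #|{: gT * gT * 'I_k}|.
Local Notation K := gcp_field.
Local Notation N := #|gT|.
Local Notation "x %:FK" := (ratfunC F #|{: gT * gT * 'I_k}| x : K) (at level 1).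

Definition gcp_var (h g : gT) (i : 'I_k) : K :=
  ratfunX F (enum_rank (h, g, i)).

(* Rows and columns are indexed by the group through [enum_rank]. *)
Definition gcp_unit (g h : gT) : 'M[K]_N :=
  delta_mx (enum_rank g) (enum_rank h).

Definition gcp_gen (g : gT) (i : 'I_k) : 'M[K]_N :=
  \sum_(h : gT) gcp_var h (h * g)%g i *: gcp_unit h (h * g)%g.

(* R_{G,k}; it contains 1 = 1%:M by [gcp_algC], and is closed under opposites
   by [gcp_algC] and [gcp_algM]. *)
Inductive gcp_alg : 'M[K]_N -> Prop :=
| gcp_algX g i : gcp_alg (gcp_gen g i)
| gcp_algC (c : F) : gcp_alg (c%:FK%:M)
| gcp_algD A B : gcp_alg A -> gcp_alg B -> gcp_alg (A + B)
| gcp_algM A B : gcp_alg A -> gcp_alg B -> gcp_alg (A *m B).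

Definition center_of (S : 'M[K]_N -> Prop) (A : 'M[K]_N) : Prop :=
  S A /\ forall B, S B -> A *m B = B *m A.

(* D_{G,k}, realized in M_|G|(K): nonzero central elements of R_{G,k} are
   invertible matrices by [gcp_alg_center_unit] below. *)
Definition gcp (A : 'M[K]_N) : Prop :=
  exists r s : 'M[K]_N, [/\ gcp_alg r, center_of gcp_alg s, s != 0 & A = r *m invmx s].

Lemma gcp_var_neq0 h g i : gcp_var h g i != 0.
Proof.
rewrite /gcp_var /ratfunX tofrac_eq0 -msupp_eq0 msuppX.
by [].
Qed.

Lemma gcp_var_inj h g h' g' i :
  gcp_var h g i = gcp_var h' g' i -> (h, g) = (h', g').
Proof.
move=> /eqP; rewrite /gcp_var /ratfunX tofrac_eq => /eqP E.
have /= /(congr1 (mcoeff U_(enum_rank (h, g, i)))) := E.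
rewrite !mcoeffX eqxx; case: eqP => [m _|_ /eqP]; last by rewrite oner_eq0.
move/mnmP: m => /(_ (enum_rank (h, g, i))); rewrite !mnm1E eqxx.
by case: eqP => // /enum_rank_inj [-> ->].
Qed.

Lemma gcp_genE g i (a b : gT) :
  gcp_gen g i (enum_rank a) (enum_rank b) =
  if b == (a * g)%g then gcp_var a b i else 0.
Proof.
rewrite /gcp_gen summxE (bigD1 a) //= big1 => [|h ha]; last first.
  by rewrite !mxE (inj_eq enum_rank_inj) eq_sym (negPf ha) mulr0.
rewrite addr0 !mxE eqxx (inj_eq enum_rank_inj) /=.
by case: eqP => [->|_]; rewrite ?mulr1 ?mulr0.
Qed.

Lemma cardG_gt0 : (0 < N)%N.
Proof. by apply/card_gt0P; exists 1%g. Qed.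

Lemma gcp_scalar_inj (c d : K) : c%:M = d%:M :> 'M[K]_N -> c = d.
Proof.
by move=> /matrixP /(_ (enum_rank 1%g) (enum_rank 1%g)); rewrite !mxE eqxx.
Qed.

Lemma gcp_scalar_eq0 (c : K) : (c%:M == 0 :> 'M[K]_N) = (c == 0).
Proof.
apply/eqP/eqP => [|->]; last by rewrite raddf0.
by move=> c0; apply: gcp_scalar_inj; rewrite c0 raddf0.
Qed.

Lemma gcp_alg_center_scalar A : center_of gcp_alg A -> exists c : K, A = c%:M.
Proof.
case: (posnP k) => [k0 [RA _]|k0 [_ cA]].
  elim: RA => [g i|c|B C _ [b ->] _ [c ->]|B C _ [b ->] _ [c ->]].
  - by move: (ltn_ord i); rewrite {2}k0.
  - by exists c%:FK.
  - by exists (b + c); rewrite raddfD.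
  - by exists (b * c); rewrite scalar_mxM.
pose i : 'I_k := Ordinal k0.
have entryL g a b : (A *m gcp_gen g i) (enum_rank a) (enum_rank (b * g)%g) =
    A (enum_rank a) (enum_rank b) * gcp_var b (b * g)%g i.
  rewrite mxE (bigD1 (enum_rank b)) //= gcp_genE eqxx big1 ?addr0 // => j jb.
  rewrite -[j]enum_valK gcp_genE; case: eqP => [/mulIg E|_]; last by rewrite mulr0.
  by rewrite E enum_valK eqxx in jb.
have entryR g a b : (gcp_gen g i *m A) (enum_rank a) (enum_rank b) =
    gcp_var a (a * g)%g i * A (enum_rank (a * g)%g) (enum_rank b).
  rewrite mxE (bigD1 (enum_rank (a * g)%g)) //= gcp_genE eqxx.
  rewrite big1 ?addr0 // => j jb.
  rewrite -[j]enum_valK gcp_genE; case: eqP => [E|_]; last by rewrite mul0r.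
  by rewrite -E enum_valK eqxx in jb.
have comm g a b : A (enum_rank a) (enum_rank b) * gcp_var b (b * g)%g i =
    gcp_var a (a * g)%g i * A (enum_rank (a * g)%g) (enum_rank (b * g)%g).
  by rewrite -entryL -entryR cA //; apply: gcp_algX.
have off a b : a != b -> A (enum_rank a) (enum_rank b) = 0.
  move=> ab; have := comm 1%g a b; rewrite !mulg1 mulrC => /eqP.
  rewrite -subr_eq0 -mulrBl mulf_eq0 subr_eq0 => /orP[/eqP|/eqP //].
  by move=> /gcp_var_inj [E _]; rewrite E eqxx in ab.
have diag a : A (enum_rank a) (enum_rank a) = A (enum_rank 1%g) (enum_rank 1%g).
  have := comm a 1%g 1%g; rewrite !mul1g mulrC => /(mulfI _) -> //.
  exact: gcp_var_neq0.
exists (A (enum_rank 1%g) (enum_rank 1%g)).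
apply/matrixP => x y; rewrite -[x]enum_valK -[y]enum_valK mxE.
rewrite (inj_eq enum_rank_inj); case: eqP => [->|/eqP xy]; first exact: diag.
exact: off.
Qed.

Lemma gcp_alg_center_unit A :
  center_of gcp_alg A -> A != 0 -> A \in unitmx.
Proof.
move=> /gcp_alg_center_scalar [c ->] c0; rewrite unitmxE det_scalar unitrX //.
by rewrite unitfE; apply: contraNneq c0 => ->; rewrite raddf0.
Qed.

Lemma gcp_alg_sub_gcp A : gcp_alg A -> gcp A.
Proof.
move=> RA; exists A, 1%:M; split=> //.
- split=> [|B _]; last by rewrite mulmx1 mul1mx.
  by have := gcp_algC 1; rewrite rmorph1.
- by rewrite gcp_scalar_eq0 oner_eq0.
- by rewrite invmx1 mulmx1.
Qed.

Lemma gcpP A : gcp A <->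
  exists (r : 'M[K]_N) (c : K), [/\ gcp_alg r, gcp_alg c%:M, c != 0 & A = c^-1 *: r].
Proof.
split=> [[r [s [Rr cs s0 ->]]]|[r [c [Rr Rc c0 ->]]]].
  have [c sc] := gcp_alg_center_scalar cs; exists r, c; split=> //.
  - by rewrite -sc; case: cs.
  - by apply: contraNneq s0 => c0; rewrite sc c0 raddf0.
  - by rewrite sc invmx_scalar mul_mx_scalar.
exists r, c%:M; split=> //.
- by split=> // B _; rewrite scalar_mxC.
- by rewrite gcp_scalar_eq0.
- by rewrite invmx_scalar mul_mx_scalar.
Qed.

Lemma gcpM A B : gcp A -> gcp B -> gcp (A *m B).
Proof.
move=> /gcpP[r [c [Rr Rc c0 ->]]] /gcpP[s [d [Rs Rd d0 ->]]]; apply/gcpP.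
exists (r *m s), (c * d); split; first exact: gcp_algM.
- by rewrite scalar_mxM; apply: gcp_algM.
- exact: (mulf_neq0 c0 d0).
- by rewrite -scalemxAl -scalemxAr scalerA invfM.
Qed.

Lemma gcpD A B : gcp A -> gcp B -> gcp (A + B).
Proof.
move=> /gcpP[r [c [Rr Rc c0 ->]]] /gcpP[s [d [Rs Rd d0 ->]]]; apply/gcpP.
exists (d%:M *m r + c%:M *m s), (c * d); split.
- by apply: gcp_algD; apply: gcp_algM.
- by rewrite scalar_mxM; apply: gcp_algM.
- exact: (mulf_neq0 c0 d0).
- exact: (addr_scaleV r s c0 d0).
Qed.

Lemma gcpC (c : F) : gcp c%:FK%:M.
Proof. exact/gcp_alg_sub_gcp/gcp_algC. Qed.

(* F(G) = Z(D_{G,k}) as a subset of M_|G|(K) *)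
Definition gcp_center : {pred 'M[K]_N} := [pred A | `[< center_of gcp A >]].

Lemma gcp_centerP A : reflect (center_of gcp A) (A \in gcp_center).
Proof. exact: asboolP. Qed.

Lemma gcp_center_scalar A : A \in gcp_center ->
  exists r c : K, [/\ gcp_alg r%:M, gcp_alg c%:M, c != 0 & A = (c^-1 * r)%:M].
Proof.
move=> /gcp_centerP [/gcpP [r [c [Rr Rc c0 ->]]] cA].
have [r0 E] : exists r0 : K, r = r0%:M.
  apply: gcp_alg_center_scalar; split=> // B /gcp_alg_sub_gcp /cA.
  rewrite -scalemxAl -scalemxAr => /(congr1 (GRing.scale c)).
  by rewrite !scalerA divff // !scale1r.
by subst r; exists r0, c; rewrite scale_scalar_mx.
Qed.

Lemma gcp_centerI (c r : K) : gcp_alg r%:M -> gcp_alg c%:M -> c != 0 ->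
  (c^-1 * r)%:M \in gcp_center.
Proof.
move=> Rr Rc c0; apply/gcp_centerP; split=> [|B _]; last by rewrite scalar_mxC.
by apply/gcpP; exists r%:M, c; rewrite scale_scalar_mx.
Qed.

Lemma gcp_centerC (c : F) : c%:FK%:M \in gcp_center.
Proof.
by apply/gcp_centerP; split=> [|B _]; [exact: gcpC | rewrite scalar_mxC].
Qed.

Lemma gcp_center_subring : subring_closed gcp_center.
Proof.
split=> [|A B|A B].
- by have := gcp_centerC 1; rewrite rmorph1.
- move=> /gcp_centerP[DA cA] /gcp_centerP[DB cB]; apply/gcp_centerP.
  have oppE C : - C = (-1)%:FK%:M *m C.
    by rewrite mul_scalar_mx rmorphN1 scaleN1r.
  split=> [|C DC]; last by rewrite mulmxBl mulmxBr cA ?cB.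
  by apply: gcpD => //; rewrite oppE; apply: gcpM => //; apply: gcpC.
- move=> /gcp_centerP[DA cA] /gcp_centerP[DB cB]; apply/gcp_centerP.
  split=> [|C DC]; first exact: gcpM.
  by rewrite -[LHS]mulmxA (cB _ DC) mulmxA (cA _ DC) -mulmxA.
Qed.

HB.instance Definition _ :=
  GRing.isSubringClosed.Build 'M[K]_N gcp_center gcp_center_subring.

Record gcpZ : Type := GcpZ {gcpZ_val :> 'M[K]_N; _ : gcpZ_val \in gcp_center}.

HB.instance Definition _ := [isSub for gcpZ_val].
HB.instance Definition _ := [Choice of gcpZ by <:].
HB.instance Definition _ :=
  GRing.SubChoice_isSubPzRing.Build 'M[K]_N gcp_center gcpZ gcp_center_subring.

Lemma gcpZ_mulC : commutative (@GRing.mul gcpZ).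
Proof.
move=> A B; apply/val_inj; rewrite !rmorphM /=.
have /gcp_centerP[_ cA] := valP A; have /gcp_centerP[DB _] := valP B.
exact: cA.
Qed.

HB.instance Definition _ := GRing.PzRing_hasCommutativeMul.Build gcpZ gcpZ_mulC.

Lemma gcpZ_oner_neq0 : 1 != 0 :> gcpZ.
Proof.
apply/eqP => /(congr1 val) /eqP; rewrite rmorph1 rmorph0.
by rewrite gcp_scalar_eq0 oner_eq0.
Qed.

HB.instance Definition _ := GRing.PzSemiRing_isNonZero.Build gcpZ gcpZ_oner_neq0.

Lemma gcpZ_inv_subproof (A : gcpZ) : invmx (val A) \in gcp_center.
Proof.
have /gcp_center_scalar [r [c [Rr Rc c0 E]]] := valP A.
have [r0|r0] := eqVneq r 0.
  have A0: val A = 0 by rewrite E r0 mulr0 raddf0.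
  by rewrite E invmx_scalar r0 mulr0 invr0 raddf0 -A0 (valP A).
by rewrite E invmx_scalar invfM invrK mulrC gcp_centerI.
Qed.

Definition gcpZ_inv (A : gcpZ) : gcpZ := GcpZ (gcpZ_inv_subproof A).

Lemma gcpZ_mulVf (A : gcpZ) : A != 0 -> gcpZ_inv A * A = 1.
Proof.
move=> A0; apply/val_inj; rewrite rmorphM rmorph1; apply: mulVmx.
have /gcp_center_scalar [r [c [_ _ _ E]]] := valP A.
rewrite E unitmxE det_scalar unitrX // unitfE; apply: contraNneq A0 => rc0.
by apply/eqP/val_inj; rewrite E rc0 raddf0 rmorph0.
Qed.

Lemma gcpZ_inv0 : gcpZ_inv 0 = 0.
Proof.
apply/val_inj; change (invmx (0 : 'M[K]_N) = 0).
by rewrite -(raddf0 (@scalar_mx K N)) invmx_scalar invr0.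
Qed.

HB.instance Definition _ :=
  GRing.ComNzRing_isField.Build gcpZ gcpZ_mulVf gcpZ_inv0.

Definition gcpZ_const_fun (c : F) : gcpZ := GcpZ (gcp_centerC c).

Lemma gcpZ_const_zmod : zmod_morphism gcpZ_const_fun.
Proof. by move=> c d; apply/val_inj; rewrite rmorphB /= !rmorphB. Qed.

Lemma gcpZ_const_monoid : monoid_morphism gcpZ_const_fun.
Proof.
split=> [|c d]; apply/val_inj; first by rewrite /= !rmorph1.
change ((c * d)%:FK%:M = c%:FK%:M *m d%:FK%:M :> 'M[K]_N).
by rewrite rmorphM scalar_mxM.
Qed.

HB.instance Definition _ :=
  GRing.isZmodMorphism.Build F gcpZ gcpZ_const_fun gcpZ_const_zmod.
HB.instance Definition _ :=
  GRing.isMonoidMorphism.Build F gcpZ gcpZ_const_fun gcpZ_const_monoid.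

End GenericCrossedProduct.

Definition gcpZ_const (F : fieldType) (gT : finGroupType) (k : nat) :
  {rmorphism F -> gcpZ F gT k} := @gcpZ_const_fun F gT k.

Section TensorProduct.
Variables (F : fieldType) (A B : comNzRingType).
Variables (iA : {rmorphism F -> A}) (iB : {rmorphism F -> B}).

(* [s] is the scalar action of F on V. *)
Definition F_bilinear (V : zmodType) (s : F -> V -> V) (f : A -> B -> V) : Prop :=
  [/\ forall a a' b, f (a + a') b = f a b + f a' b,
      forall a b b', f a (b + b') = f a b + f a b',
      forall c a b, f (iA c * a) b = s c (f a b)
    & forall c a b, f a (iB c * b) = s c (f a b)].

Definition F_linear (T : comNzRingType) (iT : {rmorphism F -> T})
    (V : lmodType F) (g : T -> V) : Prop :=
  (forall x y, g (x + y) = g x + g y) /\ (forall c x, g (iT c * x) = c *: g x).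

(* T, with structure map iT, is the F-algebra A (x)_F B, and t a b = a (x) b. *)
Definition is_tensor_product (T : comNzRingType) (iT : {rmorphism F -> T})
    (t : A -> B -> T) : Prop :=
  [/\ F_bilinear (fun c x => iT c * x) t,
      forall (V : lmodType F) (f : A -> B -> V), F_bilinear *:%R f ->
        exists g : T -> V,
          [/\ F_linear iT g, forall a b, g (t a b) = f a b
            & forall g', F_linear iT g' -> (forall a b, g' (t a b) = f a b) ->
                g' =1 g],
      t 1 1 = 1
    & forall a a' b b', t a b * t a' b' = t (a * a') (b * b')].

End TensorProduct.

(* Extensions of F are given by their structure maps. *)
Definition stably_isomorphic (F L1 L2 : fieldType)
    (i1 : {rmorphism F -> L1}) (i2 : {rmorphism F -> L2}) : Prop :=
  exists (a b : nat) (phi : {rmorphism ratfun L1 a -> ratfun L2 b}),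
    bijective phi /\ forall c : F, phi (ratfunC L1 a (i1 c)) = ratfunC L2 b (i2 c).

(* Main.v *)
(** Write x_{a,b,i} for the variables of the generic crossed product of a group
    A.  Its center consists of the scalars fixed by A in the field L_A generated
    over F by the ratios x_{1,a} x_{a,b,i} / x_{1,b}, i.e. by the Laurent
    monomials of degree 0 when x_{a,b,i} has degree [b] - [a] in Z[A].  Thus L_A
    is the function field of the kernel of a surjection from a permutation
    lattice onto the augmentation ideal I_A.

    For G = H x K with c |K| + d |H| = 1 there is an isomorphism of G-lattices
    I_G + Z[H] + Z[K] = I_H + I_K + Z + Z[G] (direct sums).  So inside one
    rational function field W with a permutation action of G, there are two
    families of variables whose degrees span the same lattice: the first
    consists of the x_{g,g',i} and of u_h, v_l; the second of the variables of H
    and of K and of z, w_g.  The monomials of degree 0 in the first family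
    generate L_G, those in the second family generate L_H L_K, and those in all
    variables generate a field M which is obtained from either of these fields
    by adjoining one monomial for each variable of the other family.  These
    monomials are algebraically independent and G permutes them up to factors
    in the smaller field, so by descent (Speiser's lemma) M^G is purely
    transcendental over F(G) = L_G^G as well as over (L_H L_K)^G.  Finally,
    taking norms of denominators and traces of numerators shows that the latter
    is the fraction field of the ring generated by F(H) and F(K), which is their
    tensor product because the two sets of variables are independent. *)

Require Import Defs.
From HB Require Import structures.
From mathcomp Require Import all_boot all_order all_algebra all_fingroup.
From mathcomp Require Import boolp.
From mathcomp Require Import mpoly.
From mathcomp Require Import ring.

Set Implicit Arguments.
Unset Strict Implicit.
Unset Printing Implicit Defensive.

Import GRing.Theory.
Local Open Scope ring_scope.

(** * Generated subfields and fractions *)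

Section GeneratedField.
Variable W : fieldType.

Inductive fgen_spec (S : W -> Prop) : W -> Prop :=
| fgen_base x of S x : fgen_spec S x
| fgen_one : fgen_spec S 1
| fgen_sub x y of fgen_spec S x & fgen_spec S y : fgen_spec S (x - y)
| fgen_div x y of fgen_spec S x & fgen_spec S y : fgen_spec S (x / y).

Definition fgen (S : W -> Prop) : {pred W} := [pred x | `[< fgen_spec S x >]].

Lemma fgenP S x : reflect (fgen_spec S x) (x \in fgen S).
Proof. exact: asboolP. Qed.

Lemma fgen_divring_closed S : divring_closed (fgen S).
Proof.
split=> [|x y /fgenP Sx /fgenP Sy|x y /fgenP Sx /fgenP Sy]; apply/fgenP.
- exact: fgen_one.
- exact: fgen_sub.
- exact: fgen_div.
Qed.

HB.instance Definition _ S :=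
  GRing.isDivringClosed.Build W (fgen S) (fgen_divring_closed S).

Lemma mem_fgen (S : W -> Prop) x : S x -> x \in fgen S.
Proof. by move=> Sx; apply/fgenP; apply: fgen_base. Qed.

Lemma fgen_min (S : W -> Prop) (T : divringClosed W) :
  (forall x, S x -> x \in T) -> {subset fgen S <= T}.
Proof.
move=> ST x /fgenP; elim=> [||y z _ Ty _ Tz|y z _ Ty _ Tz].
- exact: ST.
- exact: rpred1.
- exact: rpredB.
- exact: rpred_div.
Qed.

Definition fracs (R : {pred W}) : {pred W} :=
  [pred x | `[< exists p q, [/\ p \in R, q \in R, q != 0 & x = p / q] >]].

Lemma fracsP (R : {pred W}) x :
  reflect (exists p q, [/\ p \in R, q \in R, q != 0 & x = p / q])
          (x \in fracs R).
Proof. exact: asboolP. Qed.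

Lemma fracs_divring_closed (R : subringClosed W) : divring_closed (fracs R).
Proof.
split.
- by apply/fracsP; exists 1, 1; rewrite rpred1 oner_neq0 divr1.
- move=> x y /fracsP[p [q [Rp Rq q0 ->]]] /fracsP[p' [q' [Rp' Rq' q0' ->]]].
  apply/fracsP; exists (p * q' - p' * q), (q * q').
  by rewrite rpredB ?rpredM ?mulf_neq0 // -mulNr addf_div // mulNr.
- move=> x y /fracsP[p [q [Rp Rq q0 ->]]] /fracsP[p' [q' [Rp' Rq' q0' ->]]].
  have [->|p0'] := eqVneq p' 0.
    by apply/fracsP; exists 0, 1; rewrite rpred0 rpred1 oner_neq0 !mul0r invr0 mulr0.
  apply/fracsP; exists (p * q'), (q * p').
  by rewrite !rpredM ?mulf_neq0 // invf_div mulf_div.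
Qed.

HB.instance Definition _ (R : subringClosed W) :=
  GRing.isDivringClosed.Build W (fracs R) (fracs_divring_closed R).

Lemma sub_fracs (R : subringClosed W) : {subset R <= fracs R}.
Proof.
by move=> x Rx; apply/fracsP; exists x, 1; rewrite Rx rpred1 oner_neq0 divr1.
Qed.

Lemma fracs_min (R : {pred W}) (T : divringClosed W) :
  {subset R <= T} -> {subset fracs R <= T}.
Proof. by move=> RT x /fracsP[p [q [Rp Rq _ ->]]]; rewrite rpred_div ?RT. Qed.

Lemma fracs_common_denom (R : subringClosed W) (s : seq W) :
  {subset s <= fracs R} ->
  exists2 d, d \in R /\ d != 0 & forall x, x \in s -> d * x \in R.
Proof.
elim: s => [|x s IHs] sR; first by exists 1; rewrite ?rpred1 ?oner_neq0.
have [|d [Rd d0] ds] := IHs; first by move=> y sy; rewrite sR // inE sy orbT.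
have /fracsP[p [q [Rp Rq q0 Ex]]] := sR x (mem_head x s).
exists (d * q) => [|y]; first by rewrite rpredM ?mulf_neq0.
rewrite inE => /predU1P[->|/ds Rdy]; last by rewrite mulrAC rpredM.
by rewrite Ex -mulrA [q * _]mulrC divfK // rpredM.
Qed.

End GeneratedField.

Lemma fgen_rmorph (W W' : fieldType) (f : {rmorphism W -> W'})
    (S : W -> Prop) (S' : divringClosed W') x :
  (forall y, S y -> f y \in S') -> x \in fgen S -> f x \in S'.
Proof.
move=> SS' /fgenP; elim=> [||y z _ Sy _ Sz|y z _ Sy _ Sz].
- exact: SS'.
- by rewrite rmorph1 rpred1.
- by rewrite rmorphB rpredB.
- by rewrite fmorph_div rpred_div.
Qed.

(** * Fraction fields and algebraic independence *)

Lemma fractionE (R : idomainType) (x : {fraction R}) :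
  exists nd : R * R, nd.2 != 0 /\ x = tofrac nd.1 / tofrac nd.2.
Proof.
elim/quotW: x => x; exists (frac x); split; first exact: denom_ratioP.
set n := (frac x).1; set d := (frac x).2.
have d0 : d != 0 by exact: denom_ratioP.
have d0' : tofrac d != 0 by rewrite tofrac_eq0.
apply: (mulIf d0'); rewrite divfK //.
rewrite /tofrac; unlock FracField.tofrac => /=.
rewrite -[LHS]FracField.pi_mul; apply/eqmodP => /=.
by rewrite FracField.equivfE /FracField.mulf !numden_Ratio ?mulr1 ?oner_eq0 // mulrC.
Qed.

Section FracLift.
Variables (R : idomainType) (L : fieldType) (f : {rmorphism R -> L}).
Hypothesis f_inj : injective f.

(* [locked] prevents unification from unfolding the quotient into a product. *)
Definition frac_lift_fun of injective f : {fraction R} -> L :=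
  locked (fun x => let nd := projT1 (cid (fractionE x)) in f nd.1 / f nd.2).
Local Notation g := (frac_lift_fun f_inj).

Lemma frac_lift_funE n d : d != 0 -> g (tofrac n / tofrac d) = f n / f d.
Proof.
move=> d0; rewrite /g -lock; case: cid => -[n' d'] /= [d0' /eqP].
rewrite eqr_div ?tofrac_eq0 // -!rmorphM tofrac_eq => /eqP E.
by apply/eqP; rewrite eqr_div ?fmorph_eq0 ?raddf_eq0 // -!rmorphM E.
Qed.

Lemma frac_lift_zmod : zmod_morphism g.
Proof.
move=> x y; have [[n d] /= [d0 ->]] := fractionE x.
have [[n' d'] /= [d0' ->]] := fractionE y.
rewrite -mulNr addf_div ?tofrac_eq0 // -tofracN -!tofracM -tofracD.
rewrite !frac_lift_funE ?mulf_neq0 // -mulNr addf_div ?raddf_eq0 //.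
by rewrite -rmorphN -!rmorphM -rmorphD.
Qed.

Lemma frac_lift_monoid : monoid_morphism g.
Proof.
split=> [|x y].
  by have := frac_lift_funE 1 (oner_neq0 R); rewrite !rmorph1 !divr1.
have [[n d] /= [d0 ->]] := fractionE x; have [[n' d'] /= [d0' ->]] := fractionE y.
by rewrite mulf_div -!tofracM !frac_lift_funE ?mulf_neq0 // mulf_div -!rmorphM.
Qed.

HB.instance Definition _ :=
  GRing.isZmodMorphism.Build {fraction R} L g frac_lift_zmod.
HB.instance Definition _ :=
  GRing.isMonoidMorphism.Build {fraction R} L g frac_lift_monoid.

Definition frac_lift : {rmorphism {fraction R} -> L} := g.

Lemma frac_liftE r : frac_lift (tofrac r) = f r.
Proof.
by have := frac_lift_funE r (oner_neq0 R); rewrite !rmorph1 !divr1.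
Qed.

End FracLift.

(** This is the tool behind most identities below between compositions of evaluations and
    substitutions: they need checking only on constants and variables. *)
Lemma mpoly_rmorph_ext (n : nat) (R : nzRingType) (S : nzRingType)
    (f g : {rmorphism {mpoly R[n]} -> S}) :
  (forall c, f c%:MP = g c%:MP) -> (forall i, f 'X_i = g 'X_i) -> f =1 g.
Proof.
move=> fgC fgX p; rewrite [p]mpolyE !rmorph_sum; apply: eq_bigr => m _.
rewrite -mul_mpolyC !rmorphM fgC; congr (_ * _).
rewrite mpolyXE_id !rmorph_prod; apply: eq_bigr => i _.
by rewrite !rmorphXn fgX.
Qed.

Lemma mmap_map_mpoly (n : nat) (R : nzRingType) (S : comNzRingType)
    (f : {rmorphism R -> S}) (y : 'I_n -> S) (p : {mpoly R[n]}) :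
  mmap f y p = (map_mpoly f p).@[y].
Proof.
move: p; apply: (@mpoly_rmorph_ext _ _ _ (mmap f y) (meval y \o map_mpoly f)) => [c|i] /=.
  by rewrite mmapC map_mpolyC mevalC.
by rewrite map_mpolyX mmapX mmap1U mevalXU.
Qed.

(** Polynomial variables are numbered by ordinals, while the families below are indexed by finite
    types built from groups; this reindexing bridges the two. *)
Definition ordfam (I : finType) (T : Type) (y : I -> T) : 'I_#|I| -> T :=
  fun i => y (enum_val i).

Lemma ordfamE (I : finType) (T : Type) (y : I -> T) i :
  ordfam y i = y (enum_val i).
Proof. by []. Qed.

Lemma ordfam_rank (I : finType) (T : Type) (y : I -> T) i :
  ordfam y (enum_rank i) = y i.
Proof. by rewrite /ordfam enum_rankK. Qed.

Section AlgebraicIndependence.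
Variable W : fieldType.

(** Subfields of [W] remain predicates, so independence over [S] quantifies over polynomials with
    coefficients in [W] that happen to lie in [S]. *)
Definition algindep (S : {pred W}) (I : finType) (y : I -> W) : Prop :=
  forall p : {mpoly W[#|I|]}, p \is a mpolyOver _ S ->
    p.@[ordfam y] = 0 -> p = 0.

Lemma algindepS (S S' : {pred W}) (I : finType) (y : I -> W) :
  {subset S <= S'} -> algindep S' y -> algindep S y.
Proof. by move=> SS' yS' p pS; apply: yS'; apply: mpolyOverS pS. Qed.

End AlgebraicIndependence.

Section RatfunLift.
Variables (L W : fieldType) (e : {rmorphism L -> W}) (I : finType) (y : I -> W).

(** Passes from independence over a subset of [W] to injectivity of evaluation on polynomials over
    an abstract field, the form needed to build maps out of [ratfun]. *)
Lemma algindep_mmap (S : addrClosed W) : (forall c, e c \in S) -> algindep S y ->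
  injective (mmap e (ordfam y)).
Proof.
move=> eS yS; apply/raddf_inj => p /=; rewrite mmap_map_mpoly => /yS p0.
have {}p0 : map_mpoly e p = 0.
  apply: p0; apply/mpolyOverP => m; rewrite mcoeff_map_mpoly.
  exact: eS.
apply/mpolyP => m; apply: (fmorph_inj e).
by rewrite -mcoeff_map_mpoly p0 !mcoeff0 rmorph0.
Qed.

Hypothesis y_inj : injective (mmap e (ordfam y)).

Definition ratfun_lift : {rmorphism ratfun L #|I| -> W} := frac_lift y_inj.

Lemma ratfun_liftC c : ratfun_lift (ratfunC L _ c) = e c.
Proof. by rewrite /ratfun_lift /ratfunC /= frac_liftE /= mmapC. Qed.

Lemma ratfun_liftX i : ratfun_lift (ratfunX L (enum_rank i)) = y i.
Proof. by rewrite /ratfun_lift /ratfunX /= frac_liftE /= mmapX mmap1U ordfam_rank. Qed.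

Lemma ratfun_liftP (w : W) :
  (exists x, ratfun_lift x = w) <->
  exists p q, [/\ mmap e (ordfam y) q != 0
    & w = mmap e (ordfam y) p / mmap e (ordfam y) q].
Proof.
split=> [[x <-]|[p [q [q0 ->]]]].
  have [[p q] /= [q0 ->]] := fractionE x; exists p, q.
  rewrite (raddf_eq0 _ y_inj) q0; split=> //.
  by rewrite /ratfun_lift fmorph_div !frac_liftE.
by exists (tofrac p / tofrac q); rewrite /ratfun_lift fmorph_div !frac_liftE.
Qed.

End RatfunLift.

Lemma ratfun_rmorph_ext (L : fieldType) (n : nat) (W : fieldType)
    (f g : {rmorphism ratfun L n -> W}) :
  (forall c, f (ratfunC L n c) = g (ratfunC L n c)) ->
  (forall i, f (ratfunX L i) = g (ratfunX L i)) -> f =1 g.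
Proof.
move=> fgC fgX x; have [[p q] /= [q0 ->]] := fractionE x.
have E : f \o @tofrac {mpoly L[n]} =1 g \o @tofrac {mpoly L[n]}.
  by apply: mpoly_rmorph_ext => [c|i]; [apply: fgC | apply: fgX].
by rewrite !fmorph_div; congr (_ / _); apply: E.
Qed.

Section Range.
Variables (R : nzRingType) (W : fieldType) (f : {rmorphism R -> W}).

Definition rng (f : R -> W) : {pred W} := [pred w | `[< exists c, f c = w >]].

Lemma rngP w : reflect (exists c, f c = w) (w \in rng f).
Proof. exact: asboolP. Qed.

Lemma mem_rng c : f c \in rng f.
Proof. by apply/rngP; exists c. Qed.

Lemma rng_subring_closed : subring_closed (rng f).
Proof.
split=> [|x y /rngP[c <-] /rngP[d <-]|x y /rngP[c <-] /rngP[d <-]].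
- by rewrite -(rmorph1 f) mem_rng.
- by rewrite -rmorphB mem_rng.
- by rewrite -rmorphM mem_rng.
Qed.

HB.instance Definition _ :=
  GRing.isSubringClosed.Build W (rng f) rng_subring_closed.

Lemma mpolyOver_rng n (p : {mpoly W[n]}) :
  p \is a mpolyOver _ (rng f) -> exists p', map_mpoly f p' = p.
Proof.
move=> /mpolyOverP pf; have /choice[c fc] m : exists c, f c = p@_m by apply/rngP.
exists (\sum_(m <- msupp p) c m *: 'X_[m]).
rewrite [RHS]mpolyE rmorph_sum; apply: eq_bigr => m _.
by rewrite /= map_mpolyZ map_mpolyX fc.
Qed.

End Range.

Lemma ratfunCE (F : fieldType) (n : nat) c : ratfunC F n c = tofrac c%:MP.
Proof. by []. Qed.

Lemma ratfunXE (F : fieldType) (n : nat) i : @ratfunX F n i = tofrac 'X_i.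
Proof. by []. Qed.

Lemma ratfun_mmapE (F : fieldType) (n : nat) (p : {mpoly F[n]}) :
  mmap (ratfunC F n) (@ratfunX F n) p = tofrac p.
Proof.
move: p; apply: (@mpoly_rmorph_ext _ _ _ (mmap (ratfunC F n) (@ratfunX F n))) => [c|i] /=.
  by rewrite mmapC.
by rewrite mmapX mmap1U.
Qed.

Lemma ratfunX_indep (F : fieldType) (I : finType) :
  injective (mmap (ratfunC F _) (ordfam (fun i : I => ratfunX F (enum_rank i)))).
Proof.
apply/raddf_inj => p /=.
have -> : ordfam (fun i : I => ratfunX F (enum_rank i)) = @ratfunX F #|I|.
  by apply/funext => i; rewrite /ordfam enum_valK.
by rewrite ratfun_mmapE => /eqP; rewrite tofrac_eq0 => /eqP.
Qed.

Section Subfamilies.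
Variables (F W : fieldType) (e : {rmorphism F -> W}).

Lemma subfamily_indep (I J : finType) (s : I -> J) (x : J -> W) :
  injective s -> injective (mmap e (ordfam x)) -> injective (mmap e (ordfam (x \o s))).
Proof.
move=> s_inj x_inj.
pose eta : {rmorphism {mpoly F[#|I|]} -> {mpoly F[#|J|]}} :=
  mmap (@mpolyC _ F) (ordfam (fun i => 'X_(enum_rank (s i)))).
(* [theta] is a retraction of the renaming [eta]; it kills the variables outside the image of
   [s]. *)
pose theta : {rmorphism {mpoly F[#|J|]} -> {mpoly F[#|I|]}} :=
  mmap (@mpolyC _ F)
    (ordfam (fun j => if [pick i | s i == j] is Some i then 'X_(enum_rank i) else 0)).
have etaK : cancel eta theta.
  apply: (@mpoly_rmorph_ext _ _ _ (theta \o eta) idfun) => [c|i] /=.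
    by rewrite mmapC mmapC.
  rewrite mmapX mmap1U ordfamE mmapX mmap1U ordfam_rank.
  case: pickP => [j /eqP/s_inj ->|/(_ (enum_val i))]; last by rewrite eqxx.
  by rewrite enum_valK.
have E : mmap e (ordfam (x \o s)) =1 mmap e (ordfam x) \o eta.
  apply: (@mpoly_rmorph_ext _ _ _ _ (mmap e (ordfam x) \o eta)) => [c|i] /=.
    by rewrite !mmapC.
  by rewrite !mmapX !mmap1U !ordfamE mmapX mmap1U ordfam_rank.
move=> p q; rewrite !E => /x_inj; exact: (can_inj etaK).
Qed.

(* A relation over F(x_I) between the x_J becomes, after clearing denominators,
   an element of F[x_I][x_J], and this ring is isomorphic to F[x_I, x_J]. *)
Lemma split_indep (I J : finType) (x : I + J -> W) :
  injective (mmap e (ordfam x)) ->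
  algindep (fgen (fun w => w \in rng e \/ exists i, w = x (inl i))) (x \o inr).
Proof.
move=> x_inj p pT p0.
pose evI : {rmorphism {mpoly F[#|I|]} -> W} := mmap e (ordfam (x \o inl)).
have TR : {subset fgen (fun w => w \in rng e \/ exists i, w = x (inl i))
            <= fracs (rng evI)}.
  apply: fgen_min => w [/rngP[c <-]|[i ->]]; apply: sub_fracs; apply/rngP.
    by exists c%:MP; rewrite /= mmapC.
  by exists 'X_(enum_rank i); rewrite /= mmapX mmap1U ordfam_rank.
have [|d [Rd d0] dp] := @fracs_common_denom _ (rng evI) [seq p@_m | m <- msupp p].
  by move=> _ /mapP[m _ ->]; apply: TR; apply: (mpolyOverP _ pT).
have [|P EP] := @mpolyOver_rng _ _ evI _ (d *: p).
  apply/mpolyOverP => m; rewrite mcoeffZ.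
  have [/(map_f (fun m => p@_m)) pm|/memN_msupp_eq0->] := boolP (m \in msupp p).
    exact: dp.
  by rewrite mulr0 rpred0.
(* [eta] flattens F[x_I][x_J] to F[x_I, x_J], and [theta] below undoes it. *)
pose eta : {rmorphism {mpoly {mpoly F[#|I|]}[#|J|]} -> {mpoly F[#|{: I + J}|]}} :=
  mmap (mmap (@mpolyC _ F) (ordfam (fun i : I => 'X_(enum_rank (inl i)))))
       (ordfam (fun j : J => 'X_(enum_rank (inr j)))).
pose xv (v : I + J) : {mpoly {mpoly F[#|I|]}[#|J|]} :=
  match v with inl i => ('X_(enum_rank i))%:MP | inr j => 'X_(enum_rank j) end.
pose theta : {rmorphism {mpoly F[#|{: I + J}|]} -> {mpoly {mpoly F[#|I|]}[#|J|]}} :=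
  mmap (@mpolyC _ _ \o @mpolyC _ _) (ordfam xv).
have etaK : cancel eta theta.
  apply: (@mpoly_rmorph_ext _ _ _ (theta \o eta) idfun) => [q|j] /=; last first.
    rewrite mmapX mmap1U ordfamE mmapX mmap1U ordfam_rank /=.
    by rewrite enum_valK.
  rewrite mmapC.
  move: q; apply: (@mpoly_rmorph_ext _ _ _ (theta \o mmap _ _) (@mpolyC _ _)) => [c|i] /=.
    by rewrite !mmapC.
  by rewrite mmapX mmap1U ordfamE mmapX mmap1U ordfam_rank /= enum_valK.
have E : mmap evI (ordfam (x \o inr)) =1 mmap e (ordfam x) \o eta.
  apply: (@mpoly_rmorph_ext _ _ _ _ (mmap e (ordfam x) \o eta)) => [q|j] /=; last first.
    by rewrite !mmapX !mmap1U !ordfamE mmapX mmap1U ordfam_rank.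
  rewrite !mmapC.
  move: q; apply: (@mpoly_rmorph_ext _ _ _ evI (mmap e (ordfam x) \o mmap _ _)) => [c|i] /=.
    by rewrite !mmapC.
  by rewrite !mmapX !mmap1U !ordfamE mmapX mmap1U ordfam_rank.
have P0 : P = 0.
  apply: (can_inj etaK); apply: x_inj; rewrite !rmorph0.
  by have /= <- := E P; rewrite mmap_map_mpoly EP mevalZ p0 mulr0.
apply/eqP; have /eqP := EP; rewrite P0 rmorph0 eq_sym => /eqP dp0.
apply/eqP/mpolyP => m; apply: (mulfI d0).
by rewrite -mcoeffZ dp0 !mcoeff0 mulr0.
Qed.

End Subfamilies.

(** Substituting by [A] keeps the coefficients in [S] and turns a relation between the z into one
    between the y; it is injective since substituting by [B] undoes it. *)
Lemma algindep_lin (W : fieldType) (S : subringClosed W) (I : finType) (y z : I -> W)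
    (A B : 'M[W]_#|I|) :
  (forall i l, A i l \in S) -> (A *m B = 1%:M) ->
  (forall i, ordfam z i = \sum_l A i l * ordfam y l) ->
  algindep S y -> algindep S z.
Proof.
move=> SA AB zy yS p pS p0.
pose sub (M : 'M[W]_#|I|) : {rmorphism {mpoly W[#|I|]} -> {mpoly W[#|I|]}} :=
  mmap (@mpolyC _ W) (fun i => \sum_l M i l *: 'X_l).
have subS : sub A p \is a mpolyOver _ S.
  rewrite /sub /= /mmap rpred_sum // => m _; rewrite rpredM //.
    by rewrite mpolyOverC; apply: (mpolyOverP _ pS).
  rewrite rpred_prod // => i _; rewrite rpredX // rpred_sum // => l _.
  by rewrite mpolyOverZ ?mpolyOverX.
have sub0 : sub A p = 0.
  apply: yS => //; rewrite -[RHS]p0; move: (p).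
  apply: (@mpoly_rmorph_ext _ _ _ (meval (ordfam y) \o sub A) (meval (ordfam z))) => [c|i] /=.
    by rewrite mmapC !mevalC.
  rewrite mmapX mmap1U rmorph_sum mevalXU zy; apply: eq_bigr => l _ /=.
  by rewrite mevalZ mevalXU.
have subK : cancel (sub A) (sub B).
  apply: (@mpoly_rmorph_ext _ _ _ (sub B \o sub A) idfun) => [c|i] /=.
    by rewrite !mmapC.
  rewrite mmapX mmap1U rmorph_sum /=.
  under eq_bigr => l _ do rewrite mmapZ mmapX mmap1U mulr_sumr.
  rewrite exchange_big /= (bigD1 i) //= [X in _ + X]big1 ?addr0 => [|j ji].
    under eq_bigr => l _ do rewrite mul_mpolyC scalerA.
    rewrite -scaler_suml; have /matrixP/(_ i i) := AB; rewrite !mxE eqxx => ->.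
    by rewrite scale1r.
  under eq_bigr => l _ do rewrite mul_mpolyC scalerA.
  rewrite -scaler_suml; have /matrixP/(_ i j) := AB; rewrite !mxE eq_sym (negPf ji) => ->.
  by rewrite scale0r.
by apply: (can_inj subK); rewrite sub0 rmorph0.
Qed.

Lemma algindep_scale (W : fieldType) (S : divringClosed W) (I : finType)
    (y c : I -> W) :
  (forall i, c i \in S) -> (forall i, c i != 0) ->
  algindep S y -> algindep S (fun i => c i * y i).
Proof.
move=> cS c0; pose D (c : I -> W) : 'M[W]_#|I| := diag_mx (\row_i ordfam c i).
apply: (@algindep_lin _ S _ _ _ (D c) (D (fun i => (c i)^-1))).
- by move=> i l; rewrite !mxE; case: eqP => _; rewrite ?mulr1n ?mulr0n ?rpred0 ?cS.
- rewrite mulmx_diag; apply/matrixP => i j; rewrite !mxE.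
  by rewrite /ordfam mulfV ?c0.
- move=> i; rewrite (bigD1 i) //= big1 => [|l li].
    by rewrite !mxE eqxx mulr1n addr0.
  by rewrite !mxE eq_sym (negPf li) mulr0n mul0r.
Qed.

(** * Descent along a finite group action *)

(** Cramer's rule: the entries are cofactors divided by the determinant. For singular [A] the
    default value of [invmx A] is [A] itself. *)
Lemma mxOver_invmx (W : fieldType) (S : divringClosed W) n (A : 'M[W]_n) :
  A \is a mxOver S -> invmx A \is a mxOver S.
Proof.
move=> /mxOverP SA; rewrite /invmx; case: ifP => _; last exact/mxOverP.
have detS m (M : 'M[W]_m) : (forall i j, M i j \in S) -> \det M \in S.
  move=> SM; rewrite rpred_sum // => s _; rewrite rpredM ?rpredX ?rpredN1 //.
  exact: rpred_prod.
apply/mxOverP => i j; rewrite !mxE rpredM ?rpredV ?detS //.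
rewrite rpredM ?rpredX ?rpredN1 ?detS // => i' j'; rewrite !mxE; exact: SA.
Qed.

Section Evaluations.
Variables (W : fieldType) (S : subringClosed W) (I : finType) (z : I -> W).

Definition evals (S : {pred W}) (z : I -> W) : {pred W} :=
  [pred w | `[< exists p, p \is a mpolyOver #|I| S /\ p.@[ordfam z] = w >]].

Lemma evalsP (S' : {pred W}) w :
  reflect (exists p, p \is a mpolyOver #|I| S' /\ p.@[ordfam z] = w)
          (w \in evals S' z).
Proof. exact: asboolP. Qed.

Lemma evals_subring_closed : subring_closed (evals S z).
Proof.
split=> [|x y /evalsP[p [Sp <-]] /evalsP[q [Sq <-]]|
          x y /evalsP[p [Sp <-]] /evalsP[q [Sq <-]]]; apply/evalsP.
- by exists 1; rewrite rpred1 rmorph1.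
- by exists (p - q); rewrite rpredB // rmorphB.
- by exists (p * q); rewrite rpredM // rmorphM.
Qed.

HB.instance Definition _ :=
  GRing.isSubringClosed.Build W (evals S z) evals_subring_closed.

Lemma evals_const c : c \in S -> c \in evals S z.
Proof. by move=> Sc; apply/evalsP; exists c%:MP; rewrite mpolyOverC mevalC. Qed.

Lemma evals_var i : ordfam z i \in evals S z.
Proof. by apply/evalsP; exists 'X_i; rewrite mpolyOverX mevalXU. Qed.

Lemma evals_min (T : subringClosed W) :
  {subset S <= T} -> (forall i, z i \in T) -> {subset evals S z <= T}.
Proof.
move=> ST zT _ /evalsP[p [/mpolyOverP Sp <-]]; rewrite mevalE rpred_sum // => m _.
rewrite rpredM; [by []|exact: ST|].
by rewrite rpred_prod // => i _; rewrite rpredX // ordfamE.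
Qed.

End Evaluations.

Section Invariants.
Variables (W : fieldType) (G : finGroupType) (act : G -> {rmorphism W -> W}).
Hypothesis act1 : forall w, act 1%g w = w.
Hypothesis actM : forall g h w, act (g * h)%g w = act g (act h w).

Definition fixed (act : G -> W -> W) : {pred W} :=
  [pred w | [forall g, act g w == w]].

Lemma fixedP (a : G -> W -> W) w :
  reflect (forall g, a g w = w) (w \in fixed a).
Proof. by apply: (iffP forallP) => aw g; apply/eqP. Qed.

Lemma fixed_divring_closed : divring_closed (fixed act).
Proof.
split=> [|x y /fixedP xf /fixedP yf|x y /fixedP xf /fixedP yf]; apply/fixedP => g.
- by rewrite rmorph1.
- by rewrite rmorphB xf yf.
- by rewrite fmorph_div xf yf.
Qed.

HB.instance Definition _ :=
  GRing.isDivringClosed.Build W (fixed act) fixed_divring_closed.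

Lemma sum_act_fixed w : \sum_g act g w \in fixed act.
Proof.
apply/fixedP => g; rewrite rmorph_sum /= [RHS](reindex_inj (mulgI g)) /=.
by apply: eq_bigr => h _; rewrite actM.
Qed.

Lemma prod_act_fixed w : \prod_g act g w \in fixed act.
Proof.
apply/fixedP => g; rewrite rmorph_prod /= [RHS](reindex_inj (mulgI g)) /=.
by apply: eq_bigr => h _; rewrite actM.
Qed.

(** Take the norm N(q) as denominator. The numerator x N(q) is p times the other conjugates of q,
    hence in [R], and it is invariant because x and N(q) are. *)
Lemma fixed_fracs (R : subringClosed W) :
  (forall g x, x \in R -> act g x \in R) ->
  forall x, x \in fixed act -> x \in fracs R ->
  exists p q, [/\ p \in R /\ p \in fixed act, q \in R /\ q \in fixed act,
                  q != 0 & x = p / q].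
Proof.
move=> Ract x xf /fracsP[p [q [Rp Rq q0 Ex]]].
have Nq0 : \prod_g act g q != 0.
  by apply/prodf_neq0 => g _; rewrite fmorph_eq0.
have Nqf := prod_act_fixed q.
exists (x * \prod_g act g q), (\prod_g act g q); split=> //.
- split; last by rewrite rpredM.
  rewrite (bigD1 1%g) //= act1 Ex mulrA divfK // rpredM // rpred_prod // => g _.
  exact: Ract.
- by split=> //; rewrite rpred_prod // => g _; apply: Ract.
- by rewrite mulfK.
Qed.

Section Descent.
Variables (L0 : divringClosed W) (theta : W) (I : finType) (y : I -> W).
Hypothesis L0_act : forall g x, x \in L0 -> act g x \in L0.
Hypothesis L0_theta : theta \in L0.
Hypothesis theta_free : forall g, act g theta = theta -> g = 1%g.
Hypothesis y_indep : algindep L0 y.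
Hypothesis y_act : forall g i, exists c : I -> W,
  (forall j, c j \in L0) /\ act g (y i) = \sum_j c j * y j.

(** The nontrivial conjugates of [theta] differ from [theta] because its stabilizer is trivial, so
    the product of the linear factors vanishing at them can be normalized to 1 at [theta]. *)
Lemma lagrange_pol : exists P : {poly W},
  (size P <= #|G|)%N /\ forall g, P.[act g theta] = (g == 1%g)%:R.
Proof.
pose Q : {poly W} := \prod_(g | g != 1%g) ('X - (act g theta)%:P).
have Q0 : Q.[theta] != 0.
  rewrite horner_prod; apply/prodf_neq0 => g g1.
  rewrite hornerXsubC subr_eq0; apply: contraNneq g1 => /esym E.
  by apply/eqP/theta_free.
exists (Q.[theta]^-1 *: Q); split=> [|g].
  apply: leq_trans (size_scale_leq _ _) _; rewrite /Q -big_filter size_prod_XsubC.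
  rewrite size_filter -sum1_count (eq_bigl (mem (predC1 (1%g : G)))) // sum1_card.
  by rewrite cardC1 prednK //; apply/card_gt0P; exists 1%g.
rewrite hornerZ; have [->|g1] := eqVneq g 1%g; first by rewrite act1 mulVf.
have -> : Q.[act g theta] = 0; last by rewrite mulr0.
by rewrite horner_prod (bigD1 g) //= hornerXsubC subrr mul0r.
Qed.

Lemma lin_indep (c : 'I_#|I| -> W) : (forall i, c i \in L0) ->
  \sum_i c i * ordfam y i = 0 -> forall i, c i = 0.
Proof.
move=> cL0 c0 i; have pL0 : \sum_i c i *: 'X_i \is a mpolyOver #|I| L0.
  by rewrite rpred_sum // => j _; rewrite mpolyOverZ ?mpolyOverX.
have /y_indep p0 := pL0; rewrite -[c i]mulr1.
transitivity ((\sum_j c j *: 'X_j)@_U_(i)); last first.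
  rewrite p0 ?mcoeff0 // rmorph_sum /= -[RHS]c0; apply: eq_bigr => j _.
  by rewrite mevalZ mevalXU.
rewrite raddf_sum /= (bigD1 i) //= big1 => [|j ji].
  by rewrite mcoeffZ mcoeffXU eqxx addr0.
by rewrite mcoeffZ mcoeffXU (negPf ji) mulr0.
Qed.

(* The y_i are combinations of the invariants Tr(theta^j y_i) by Lagrange
   interpolation at the distinct conjugates of theta; hence some of these
   invariants form a basis of the space spanned by the y_i. *)
Lemma invariant_basis : exists z : I -> W,
  [/\ forall i, z i \in fixed act, algindep L0 z,
      forall i, exists b : 'I_#|I| -> W,
        (forall j, b j \in L0) /\ y i = \sum_j b j * ordfam z j
    & forall i, exists b : 'I_#|I| -> W,
        (forall j, b j \in L0) /\ z i = \sum_j b j * ordfam y j].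
Proof.
pose Y := ordfam y.
have /choice[C' C'P] (gi : G * 'I_#|I|) : exists c : 'I_#|I| -> W,
    (forall j, c j \in L0) /\ act gi.1 (Y gi.2) = \sum_j c j * Y j.
  have [c [cL0 Ec]] := y_act gi.1 (enum_val gi.2); exists (ordfam c); split=> [j|].
    exact: cL0.
  rewrite /Y [ordfam y _]ordfamE Ec (reindex (@enum_val _ I)) //=.
  by apply: onW_bij; apply: enum_val_bij.
pose C g i j := C' (g, i) j.
have CL0 g i j : C g i j \in L0 by have [+ _] := C'P (g, i); apply.
have CE g i : act g (Y i) = \sum_j C g i j * Y j by have [] := C'P (g, i).
have C1 i j : C 1%g i j = (i == j)%:R.
  apply/eqP; rewrite -subr_eq0; apply/eqP; move: j.
  apply: (@lin_indep (fun j => C 1%g i j - (i == j)%:R)) => [j|].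
    by rewrite rpredB ?rpred_nat.
  under eq_bigr => j _ do rewrite mulrBl.
  rewrite sumrB -CE act1 (bigD1 i) //= big1 => [|j ji].
    by rewrite eqxx mul1r addr0 subrr.
  by rewrite eq_sym (negPf ji) mul0r.
have [P [sP Pact]] := lagrange_pol.
pose N := #|{: 'I_#|I| * 'I_#|G|}|.
pose ev (r : 'I_N) : 'I_#|I| * 'I_#|G| := enum_val r.
(* The row indexed by (i, j) holds the coordinates, in the y_l, of the trace of theta^j y_i. *)
pose T : 'M[W]_(N, #|I|) := \matrix_(r, l)
  \sum_g act g theta ^+ (ev r).2 * C g (ev r).1 l.
have TL0 r l : T r l \in L0.
  by rewrite mxE rpred_sum // => g _; rewrite rpredM ?rpredX ?L0_act.
pose t (r : 'I_N) := \sum_g act g (theta ^+ (ev r).2 * Y (ev r).1).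
have tE r : t r = \sum_l T r l * Y l.
  under [RHS]eq_bigr => l _ do rewrite mxE mulr_suml.
  rewrite exchange_big /=; apply: eq_bigr => g _.
  rewrite rmorphM rmorphXn CE mulr_sumr; apply: eq_bigr => l _.
  by rewrite mulrA.
have Tfull : row_full T.
  (* A left inverse of [T]: weighting the traces of theta^j y_i by the coefficients of [P] kills
     every term with g != 1 and leaves y_i. *)
  apply/row_fullP; exists (\matrix_(i, r)
    if (ev r).1 == i then P`_(ev r).2 else 0).
  apply/matrixP => i l; rewrite mxE.
  under eq_bigr => r _ do rewrite mxE [T _ _]mxE.
  rewrite (reindex (@enum_rank _)) /=; last by apply: onW_bij; apply: enum_rank_bij.
  under eq_bigr => ij _ do rewrite /ev enum_rankK.
  rewrite -(pair_bigA _ (fun (i' : 'I_#|I|) (j : 'I_#|G|) =>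
    (if i' == i then P`_j else 0) * \sum_g act g theta ^+ j * C g i' l)) /=.
  rewrite (bigD1 i) //= [X in _ + X]big1 ?addr0 => [|i' ii']; last first.
    by rewrite big1 // => j _; rewrite (negPf ii') mul0r.
  rewrite eqxx; under eq_bigr => j _ do rewrite mulr_sumr.
  rewrite exchange_big /=.
  under eq_bigr => g _.
    under eq_bigr => j _ do rewrite mulrA.
    rewrite -mulr_suml -horner_coef_wide // Pact.
    over.
  rewrite (bigD1 1%g) //= big1 ?addr0 => [|g g1]; last by rewrite (negPf g1) mul0r.
  by rewrite eqxx mul1r C1 mxE.
(* Select rows of [T] that form an invertible matrix; its inverse again has entries in [L0]. *)
pose f := fullrankfun Tfull.
pose A := rowsub f T.
have Aunit : A \in unitmx by apply: fullrowsub_unit.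
have AL0 : A \is a mxOver L0 by apply/mxOverP => i j; rewrite mxE.
have BL0 : invmx A \is a mxOver L0 by apply: mxOver_invmx.
pose z i := t (f (enum_rank i)).
have zE i : ordfam z i = \sum_l A i l * Y l.
  rewrite ordfamE /z enum_valK tE; apply: eq_bigr => l _.
  by rewrite [in RHS]mxE.
have yE i : Y i = \sum_j (invmx A) i j * ordfam z j.
  under eq_bigr => j _ do rewrite zE mulr_sumr.
  rewrite exchange_big /=.
  under eq_bigr => l _.
    under eq_bigr => j _ do rewrite mulrA.
    rewrite -mulr_suml.
    over.
  have BA l : \sum_j invmx A i j * A j l = (i == l)%:R.
    by have /matrixP/(_ i l) := mulVmx Aunit; rewrite mxE => ->; rewrite mxE.
  rewrite (bigD1 i) //= [X in _ + X]big1 => [|l li].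
    by rewrite BA eqxx mul1r addr0.
  by rewrite BA eq_sym (negPf li) mul0r.
exists z; split.
- by move=> i; apply: sum_act_fixed.
- apply: (@algindep_lin _ _ _ y z A (invmx A)) => //.
  + by move=> i j; apply: (mxOverP AL0).
  + by rewrite mulmxV.
- move=> i; exists (fun j => invmx A (enum_rank i) j); split.
    by move=> j; apply: (mxOverP BL0).
  by rewrite -yE /Y ordfam_rank.
- move=> i; exists (fun j => A (enum_rank i) j); split.
    by move=> j; apply: (mxOverP AL0).
  by rewrite -zE ordfam_rank.
Qed.

(** Replace the y_i by the invariant basis z. An invariant of the field generated by [L0] and the
    y_i is a quotient of invariants of the ring L0[z], and these are the polynomials in z over the
    invariants of [L0], that is, over [rng e]. *)
Lemma ratfun_descent (L1 : fieldType) (e : {rmorphism L1 -> W}) :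
  (forall w, (w \in rng e) = (w \in L0) && (w \in fixed act)) ->
  exists phi : {rmorphism ratfun L1 #|I| -> W},
    (forall c, phi (ratfunC L1 _ c) = e c) /\
    forall w, (exists x, phi x = w) <->
      w \in fgen (fun v => v \in L0 \/ exists i, v = y i) /\ w \in fixed act.
Proof.
move=> rng_e; have [z [z_fixed z_indep yz zy]] := invariant_basis.
have eL0 c : e c \in L0 by have := mem_rng e c; rewrite rng_e => /andP[].
have e_fixed c : e c \in fixed act by have := mem_rng e c; rewrite rng_e => /andP[].
have z_inj := algindep_mmap eL0 z_indep.
exists (ratfun_lift z_inj); split; first exact: ratfun_liftC.
set M := fgen _.
have zM i : z i \in M.
  have [b [bL0 ->]] := zy i; rewrite rpred_sum // => j _; apply: rpredM.
    by apply: mem_fgen; left.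
  by apply: mem_fgen; right; exists (enum_val j).
have ME p : mmap e (ordfam z) p \in M /\ mmap e (ordfam z) p \in fixed act.
  split.
    apply: (@evals_min _ L0 _ z) => [c cL0||].
    - by apply: mem_fgen; left.
    - exact: zM.
    - apply/evalsP; exists (map_mpoly e p); rewrite -mmap_map_mpoly; split=> //.
      apply/mpolyOverP => m; rewrite mcoeff_map_mpoly; exact: eL0.
  rewrite mmap_map_mpoly mevalE rpred_sum // => m _.
  rewrite mcoeff_map_mpoly; apply: rpredM; first exact: e_fixed.
  by apply: rpred_prod => i _; apply: rpredX; apply: z_fixed.
(* Since the z_i are fixed, applying g to the value of p only conjugates its coefficients; by
   independence these are then fixed, so they lie in [rng e]. *)
have evalsE w : w \in evals L0 z -> w \in fixed act -> exists p, mmap e (ordfam z) p = w.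
  move=> /evalsP[p [pL0 <-]] /fixedP pf.
  have [|p' <-] := @mpolyOver_rng _ _ e _ p; last first.
    by exists p'; rewrite mmap_map_mpoly.
  apply/mpolyOverP => m; rewrite rng_e (mpolyOverP _ pL0) /=.
  apply/fixedP => g; apply/eqP; rewrite -mcoeff_map_mpoly -subr_eq0 -mcoeffB.
  suff -> : map_mpoly (act g) p - p = 0 by rewrite mcoeff0.
  apply: z_indep.
    rewrite rpredB //; apply/mpolyOverP => m'; rewrite mcoeff_map_mpoly.
    by rewrite L0_act // (mpolyOverP _ pL0).
  apply/eqP; rewrite rmorphB subr_eq0 /= -[X in _ == X](pf g); apply/eqP.
  rewrite -mmap_map_mpoly; move: (p).
  apply: (@mpoly_rmorph_ext _ _ _ (mmap (act g) (ordfam z)) (act g \o meval (ordfam z))) => [c|i] /=.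
    by rewrite mmapC mevalC.
  by rewrite mmapX mmap1U mevalXU ordfamE (fixedP _ _ (z_fixed _)).
move=> w; rewrite ratfun_liftP; split=> [[p [q [q0 ->]]]|[Mw wf]].
  by have [pM pf] := ME p; have [qM qf] := ME q; rewrite !rpred_div.
have MR : {subset M <= fracs (evals L0 z)}.
  apply: fgen_min => v [vL0|[i ->]]; apply: sub_fracs; first exact: evals_const.
  have [b [bL0 ->]] := yz i; rewrite rpred_sum // => j _; apply: rpredM.
    exact: evals_const.
  exact: evals_var.
have [|p [q [[pR pf] [qR qf] q0 ->]]] := @fixed_fracs (evals L0 z) _ w wf (MR _ Mw).
  move=> g _ /evalsP[p [/mpolyOverP pL0 <-]]; rewrite mevalE rmorph_sum rpred_sum // => m _.
  rewrite rmorphM; apply: rpredM; first by apply: evals_const; apply: L0_act.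
  rewrite rmorph_prod; apply: rpred_prod => i _; rewrite rmorphXn.
  apply: rpredX; rewrite ordfamE /= (fixedP _ _ (z_fixed _)) -ordfamE.
  exact: evals_var.
have [p' Ep] := evalsE p pR pf; have [q' Eq] := evalsE q qR qf.
by exists p', q'; rewrite Ep Eq.
Qed.

End Descent.

End Invariants.

(** * Maps permuting variables *)

Section VariableMaps.
Variable F : fieldType.

Definition rvar (I : finType) (i : I) : ratfun F #|I| := ratfunX F (enum_rank i).

Lemma rvarE (I : finType) (i : I) : rvar i = ratfunX F (enum_rank i).
Proof. by []. Qed.

(* Otherwise [/=] and [//] start computing in the fraction field. *)
#[global] Opaque ratfunC ratfunX rvar.

Section Rincl.
Variables (I J : finType) (s : I -> J) (s_inj : injective s).

Definition rincl : {rmorphism ratfun F #|I| -> ratfun F #|J|} :=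
  ratfun_lift (subfamily_indep s_inj (@ratfunX_indep F J)).

Lemma rinclC c : rincl (ratfunC F _ c) = ratfunC F _ c.
Proof. exact: ratfun_liftC. Qed.

Lemma rinclX i : rincl (rvar i) = rvar (s i).
Proof. exact: ratfun_liftX. Qed.

End Rincl.
#[global] Opaque rincl.

Lemma rvar_rmorph_ext (I : finType) (W : fieldType) (f g : {rmorphism ratfun F #|I| -> W}) :
  (forall c, f (ratfunC F _ c) = g (ratfunC F _ c)) ->
  (forall i, f (rvar i) = g (rvar i)) -> f =1 g.
Proof.
move=> fgC fgX; apply: ratfun_rmorph_ext => // i.
by rewrite -[i]enum_valK; apply: fgX.
Qed.

Lemma rincl_comp (I J J' L : finType) (s : I -> J) (t : J -> L) (s' : I -> J') (t' : J' -> L)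
    (s_inj : injective s) (t_inj : injective t)
    (s_inj' : injective s') (t_inj' : injective t') :
  t \o s =1 t' \o s' ->
  forall x, rincl t_inj (rincl s_inj x) = rincl t_inj' (rincl s_inj' x).
Proof.
move=> E; apply: (@rvar_rmorph_ext _ _ (rincl t_inj \o rincl s_inj) (rincl t_inj' \o rincl s_inj')) => [c|i] /=.
  by rewrite !rinclC.
by rewrite !rinclX; congr rvar; apply: E.
Qed.

Lemma rincl_id (I : finType) (s : I -> I) (s_inj : injective s) :
  s =1 id -> forall x, rincl s_inj x = x.
Proof.
move=> E; apply: (@rvar_rmorph_ext _ _ (rincl s_inj) idfun) => [c|i] /=.
  by rewrite rinclC.
by rewrite rinclX E.
Qed.

Section VariableAction.
Variables (G : finGroupType) (I : finType) (to : G -> I -> I).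
Hypothesis to1 : forall i, to 1%g i = i.
Hypothesis toM : forall g h i, to (g * h)%g i = to g (to h i).

Lemma to_inj g : injective (to g).
Proof. by apply: (can_inj (g := to g^-1%g)) => i; rewrite -toM mulVg to1. Qed.

Definition rvact g := rincl (@to_inj g).

Lemma rvact1 x : rvact 1%g x = x.
Proof. exact: rincl_id. Qed.

Lemma rvactM g h x : rvact (g * h)%g x = rvact g (rvact h x).
Proof.
(* An identity renaming is inserted so that both sides are compositions of two renamings, as
   [rincl_comp] requires. *)
transitivity (rincl (@inj_id I) (rvact (g * h)%g x)).
  by symmetry; apply: rincl_id.
by apply: rincl_comp => i; apply: toM.
Qed.

End VariableAction.

End VariableMaps.

(** * The center of the generic crossed product *)

(** The formal identity behind [loopfield_act]: it moves the base point of a loop from g back to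
    1. *)
Lemma telescope_ratio (L : fieldType) (a b c d m s : L) :
  b != 0 -> c != 0 -> d != 0 -> s != 0 ->
  a * m / d = (s * a / b) * (b * m / c) / (s * d / c).
Proof. by move=> b0 c0 d0 s0; field; rewrite b0 c0 d0 s0. Qed.

Section CenterOfGenericCrossedProduct.
Variables (F : fieldType) (gT : finGroupType) (k : nat) (i0 : 'I_k).
Local Notation K := (gcp_field F gT k).
Local Notation N := #|gT|.
Local Notation x := (@gcp_var F gT k).
Local Notation rk := (@enum_rank gT).
Local Notation gen := (@gcp_gen F gT k).
Local Notation constF := (ratfunC F #|{: gT * gT * 'I_k}|).

Definition translate (g : gT) (e : gT * gT * 'I_k) : gT * gT * 'I_k :=
  (g * e.1.1, g * e.1.2, e.2)%g.

Lemma translate1 e : translate 1%g e = e.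
Proof. by case: e => [[a b] i]; rewrite /translate !mul1g. Qed.

Lemma translateM g h e : translate (g * h)%g e = translate g (translate h e).
Proof. by rewrite /translate /= !mulgA. Qed.

Definition gcp_act (g : gT) : {rmorphism K -> K} :=
  rvact F translate1 translateM g.

Lemma gcp_act1 w : gcp_act 1%g w = w.
Proof. exact: rvact1. Qed.

Lemma gcp_actM g h w : gcp_act (g * h)%g w = gcp_act g (gcp_act h w).
Proof. exact: rvactM. Qed.

Lemma gcp_actC g c : gcp_act g (constF c) = constF c.
Proof. exact: rinclC. Qed.

Lemma gcp_varE a b i : x a b i = rvar F (a, b, i).
Proof. by rewrite rvarE. Qed.

Lemma gcp_actX g a b i : gcp_act g (x a b i) = x (g * a)%g (g * b)%g i.
Proof. by rewrite !gcp_varE; apply: rinclX. Qed.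
#[local] Opaque gcp_act gcp_var.

(** The field L_G. Its generators are the closed walks 1 -> g -> g' -> 1 whose last edge is
    traversed backwards; the edges at 1 carry the fixed index [i0]. *)
Definition loopfield : {pred K} :=
  fgen (fun w => w \in rng constF \/
    exists g g' i, w = x 1%g g i0 * x g g' i / x 1%g g' i0).

(** Equivariance holds for the generators and survives products by translating the summation index.
    In particular the row at 1 determines the whole matrix. *)
Lemma gcp_alg_act B : gcp_alg B -> forall g a b,
  gcp_act g (B (rk a) (rk b)) = B (rk (g * a)%g) (rk (g * b)%g).
Proof.
elim=> [h i|c|B1 B2 _ IH1 _ IH2|B1 B2 _ IH1 _ IH2] g a b.
- rewrite !gcp_genE -mulgA (inj_eq (mulgI g)).
  by case: eqP => _; rewrite ?gcp_actX ?rmorph0.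
- rewrite !mxE !(inj_eq enum_rank_inj) (inj_eq (mulgI g)) rmorphMn.
  by congr (_ *+ _); apply: gcp_actC.
- by rewrite !mxE rmorphD IH1 IH2.
- rewrite !mxE rmorph_sum (reindex (@enum_rank gT)) /=; last first.
    by apply: onW_bij; apply: enum_rank_bij.
  rewrite [RHS](reindex (fun h : gT => rk (g * h)%g)) /=; last first.
    apply: onW_bij; apply: bij_comp; first exact: enum_rank_bij.
    by exists (fun h => g^-1 * h)%g => h; rewrite (mulKg, mulKVg).
  by apply: eq_bigr => h _; rewrite rmorphM IH1 IH2.
Qed.

Lemma loopfield_const c : constF c \in loopfield.
Proof. by apply: mem_fgen; left; apply: mem_rng. Qed.

Lemma loopfieldX g g' i : x 1%g g i0 * x g g' i / x 1%g g' i0 \in loopfield.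
Proof. by apply: mem_fgen; right; exists g, g', i. Qed.

(** In other words, conjugation by the diagonal matrix of the x_{1,a} carries the algebra into
    matrices over L_G: the intermediate factors x_{1,h} cancel in a product. *)
Lemma gcp_alg_loopfield B : gcp_alg B -> forall a b,
  x 1%g a i0 * B (rk a) (rk b) / x 1%g b i0 \in loopfield.
Proof.
elim=> [h i|c|B1 B2 _ IH1 _ IH2|B1 B2 _ IH1 _ IH2] a b.
- rewrite gcp_genE; case: eqP => [->|_]; first exact: loopfieldX.
  by rewrite mulr0 mul0r; apply: rpred0.
- rewrite mxE (inj_eq enum_rank_inj); case: eqP => [->|_].
    rewrite mulr1n [_ * constF c]mulrC mulfK; first exact: loopfield_const.
    exact: gcp_var_neq0.
  by rewrite mulr0n mulr0 mul0r; apply: rpred0.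
- by rewrite mxE mulrDr mulrDl; apply: rpredD.
- rewrite mxE mulr_sumr mulr_suml; apply: rpred_sum => j _.
  rewrite -[j]enum_valK; set h := enum_val j.
  have -> : x 1%g a i0 * (B1 (rk a) (rk h) * B2 (rk h) (rk b)) / x 1%g b i0 =
    (x 1%g a i0 * B1 (rk a) (rk h) / x 1%g h i0) *
    (x 1%g h i0 * B2 (rk h) (rk b) / x 1%g b i0).
    rewrite !mulrA; congr (_ * _ / _); rewrite divfK //.
    exact: gcp_var_neq0.
  exact: rpredM.
Qed.

Lemma gen_mulE g i (M : 'M[K]_N) a j :
  (gen g i *m M) (rk a) j = x a (a * g)%g i * M (rk (a * g)%g) j.
Proof.
rewrite mxE (bigD1 (rk (a * g)%g)) //= gcp_genE eqxx big1 ?addr0 // => l la.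
rewrite -[l]enum_valK gcp_genE; case: eqP => [E|_]; last by rewrite mul0r.
by rewrite -E enum_valK eqxx in la.
Qed.

(* The elements of the generic crossed product which are diagonal matrices are
   of this form, by [gcp_alg_act]. *)
Definition orbit_mx (f : K) : 'M[K]_N := diag_mx (\row_j gcp_act (enum_val j) f).

Lemma orbit_mxE f a j : orbit_mx f (rk a) j = if rk a == j then gcp_act a f else 0.
Proof. by rewrite !mxE enum_rankK; case: eqP; rewrite ?mulr1n ?mulr0n. Qed.

Lemma orbit_mx_fixed f : f \in fixed gcp_act -> orbit_mx f = f%:M.
Proof.
move=> /fixedP ff; apply/matrixP => a j; rewrite -[a]enum_valK orbit_mxE mxE.
by rewrite ff; case: eqP.
Qed.

Definition alg_orbits : {pred K} := [pred f | `[< gcp_alg (orbit_mx f) >]].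

Lemma alg_orbitsP f : reflect (gcp_alg (orbit_mx f)) (f \in alg_orbits).
Proof. exact: asboolP. Qed.

Lemma alg_orbits_const c : constF c \in alg_orbits.
Proof.
apply/alg_orbitsP; rewrite orbit_mx_fixed; first exact: gcp_algC.
by apply/fixedP => g; apply: gcp_actC.
Qed.

Lemma alg_orbits_subring : subring_closed alg_orbits.
Proof.
have orbM f g : orbit_mx (f * g) = orbit_mx f *m orbit_mx g.
  rewrite /orbit_mx mulmx_diag; congr diag_mx.
  by apply/rowP => j; rewrite !mxE rmorphM.
split=> [|f g /alg_orbitsP Rf /alg_orbitsP Rg|f g /alg_orbitsP Rf /alg_orbitsP Rg].
- by rewrite -(rmorph1 constF); apply: alg_orbits_const.
- apply/alg_orbitsP.
  have -> : orbit_mx (f - g) = orbit_mx f + orbit_mx (constF (-1)) *m orbit_mx g.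
    rewrite -orbM /orbit_mx -raddfD; congr diag_mx; apply/rowP => j; rewrite !mxE.
    by rewrite rmorphB rmorphN1 mulN1r rmorphN.
  apply: gcp_algD => //; apply: gcp_algM => //; apply/alg_orbitsP.
  exact: alg_orbits_const.
- by apply/alg_orbitsP; rewrite orbM; apply: gcp_algM.
Qed.

HB.instance Definition _ :=
  GRing.isSubringClosed.Build K alg_orbits alg_orbits_subring.

(** Up to the factors needed to walk from 1 to g and back, [alg_orbits] is stable under g: the
    matrix is X_{g,i} * [orbit_mx f] * X_{g^-1,j}. *)
Lemma alg_orbits_conj g i j f : f \in alg_orbits ->
  x 1%g g i * gcp_act g f * x g 1%g j \in alg_orbits.
Proof.
move=> /alg_orbitsP Rf; apply/alg_orbitsP.
have -> : orbit_mx (x 1%g g i * gcp_act g f * x g 1%g j) =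
    gen g i *m (orbit_mx f *m gen g^-1 j).
  apply/matrixP => a b; rewrite -[a]enum_valK -[b]enum_valK.
  set a' := enum_val a; set b' := enum_val b.
  rewrite gen_mulE orbit_mxE (inj_eq enum_rank_inj) /orbit_mx mul_diag_mx.
  rewrite [X in _ = _ * X]mxE [X in _ = _ * (X * _)]mxE enum_rankK gcp_genE mulgK eq_sym.
  case: eqP => [->|_]; last by rewrite !mulr0.
  by rewrite !rmorphM !gcp_actX -gcp_actM !mulg1 mulrA.
by apply: gcp_algM; [|apply: gcp_algM => //]; apply: gcp_algX.
Qed.

(** Multiply the generators along the closed walk 1 -> g -> g' -> 1; their group degrees multiply to
    1, so the product is diagonal. *)
Lemma alg_orbits_triangle g g' i :
  x 1%g g i0 * x g g' i * x g' 1%g i0 \in alg_orbits.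
Proof.
apply/alg_orbitsP.
have -> : orbit_mx (x 1%g g i0 * x g g' i * x g' 1%g i0) =
    gen g i0 *m (gen (g^-1 * g')%g i *m gen g'^-1 i0).
  apply/matrixP => a b; rewrite -[a]enum_valK -[b]enum_valK.
  set a' := enum_val a; set b' := enum_val b.
  rewrite !gen_mulE orbit_mxE (inj_eq enum_rank_inj) gcp_genE -!mulgA !mulKVg mulgV mulg1 eq_sym.
  case: eqP => [->|_]; last by rewrite !mulr0.
  by rewrite !rmorphM !gcp_actX !mulg1 mulrA.
by apply: gcp_algM; [|apply: gcp_algM]; apply: gcp_algX.
Qed.

Lemma alg_orbits_return g : x 1%g g i0 * x g 1%g i0 \in alg_orbits.
Proof.
have := alg_orbits_conj g i0 i0 (rpred1 alg_orbits).
by rewrite rmorph1 mulr1.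
Qed.

Lemma loopfield_fracs : {subset loopfield <= fracs alg_orbits}.
Proof.
apply: fgen_min => w [/rngP[c <-]|[g [g' [i ->]]]].
  by apply: sub_fracs; apply: alg_orbits_const.
(* Multiplying numerator and denominator by x_{g',1} closes both walks. *)
apply/fracsP; exists (x 1%g g i0 * x g g' i * x g' 1%g i0), (x 1%g g' i0 * x g' 1%g i0).
split.
- exact: alg_orbits_triangle.
- exact: alg_orbits_return.
- by apply: mulf_neq0; apply: gcp_var_neq0.
- by rewrite -mulf_div divff ?mulr1 //; apply: gcp_var_neq0.
Qed.

(* [alg_orbits] is not stable under the group: translating by g a closed walk
   based at 1 gives one based at g, so the conjugates in the norm of a
   denominator have to be multiplied by x_{1,g} x_{g,1}. *)
Lemma loopfield_fixed_fracs f : f \in loopfield -> f \in fixed gcp_act ->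
  exists p q, [/\ p \in alg_orbits /\ p \in fixed gcp_act,
    q \in alg_orbits /\ q \in fixed gcp_act, q != 0 & f = p / q].
Proof.
move=> /loopfield_fracs /fracsP[p [q [Rp Rq q0 Ef]]] ff.
pose c g := x 1%g g i0 * x g 1%g i0.
have c0 g : c g != 0 by apply: mulf_neq0; apply: gcp_var_neq0.
(* In the norm of C * q the factor at 1 contains [C], which provides one [c g] for each other
   conjugate; so the norm is q times the element [R] of [alg_orbits]. *)
pose C := \prod_g c g.
have RC : C \in alg_orbits by apply: rpred_prod => g _; apply: alg_orbits_return.
pose R := c 1%g * \prod_(g | g != 1%g) (x 1%g g i0 * gcp_act g (C * q) * x g 1%g i0).
have RR : R \in alg_orbits.
  apply: rpredM; first exact: alg_orbits_return.
  by apply: rpred_prod => g _; apply: alg_orbits_conj; apply: rpredM.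
have NE : \prod_g gcp_act g (C * q) = q * R.
  rewrite (bigD1 1%g) //= gcp_act1 {1}/C (bigD1 1%g) //= /R.
  have -> : \prod_(g | g != 1%g) (x 1%g g i0 * gcp_act g (C * q) * x g 1%g i0) =
      \prod_(g | g != 1%g) c g * \prod_(g | g != 1%g) gcp_act g (C * q).
    by rewrite -big_split; apply: eq_bigr => g _; rewrite mulrAC.
  set P := \prod_(g | g != 1%g) c g; set P' := \prod_(g | g != 1%g) gcp_act _ _.
  by rewrite [_ * q]mulrC -!mulrA.
have Nf := prod_act_fixed gcp_actM (C * q).
have N0 : \prod_g gcp_act g (C * q) != 0.
  apply/prodf_neq0 => g _; rewrite fmorph_eq0; apply: mulf_neq0; last exact: q0.
  by apply/prodf_neq0 => h _; apply: c0.
have NR : \prod_g gcp_act g (C * q) \in alg_orbits by rewrite NE; apply: rpredM.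
exists (f * \prod_g gcp_act g (C * q)), (\prod_g gcp_act g (C * q)).
split; [split|split| |].
- by rewrite NE Ef mulrA divfK //; apply: rpredM.
- exact: rpredM.
- exact: NR.
- exact: Nf.
- exact: N0.
- by rewrite (mulfK N0).
Qed.

Lemma loopfield_act g w : w \in loopfield -> gcp_act g w \in loopfield.
Proof.
apply: fgen_rmorph => v [/rngP[c <-]|[a [b [i ->]]]].
  by rewrite gcp_actC; apply: loopfield_const.
rewrite fmorph_div rmorphM !gcp_actX mulg1.
have -> : x g (g * a)%g i0 * x (g * a)%g (g * b)%g i / x g (g * b)%g i0 =
  (x 1%g g i0 * x g (g * a)%g i0 / x 1%g (g * a)%g i0) *
  (x 1%g (g * a)%g i0 * x (g * a)%g (g * b)%g i / x 1%g (g * b)%g i0) /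
  (x 1%g g i0 * x g (g * b)%g i0 / x 1%g (g * b)%g i0).
  by apply: telescope_ratio; apply: gcp_var_neq0.
by apply: rpred_div; first apply: rpredM; apply: loopfieldX.
Qed.

(** Central elements are scalar matrices, so this single entry embeds the center into [K]. *)
Definition gcpZ_entry (A : gcpZ F gT k) : K := val A (rk 1%g) (rk 1%g).

Lemma gcpZ_entryE A : val A = (gcpZ_entry A)%:M.
Proof.
have [r [c [_ _ _ E]]] := gcp_center_scalar (valP A).
rewrite /gcpZ_entry E; congr (_%:M).
by rewrite [RHS]mxE eqxx.
Qed.

Lemma gcpZ_entry_zmod : zmod_morphism gcpZ_entry.
Proof. by move=> A B; rewrite /gcpZ_entry rmorphB !mxE. Qed.

Lemma gcpZ_entry_monoid : monoid_morphism gcpZ_entry.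
Proof.
split=> [|A B]; first by rewrite /gcpZ_entry rmorph1 mxE eqxx.
apply: gcp_scalar_inj; rewrite -gcpZ_entryE scalar_mxM -!gcpZ_entryE.
exact: rmorphM.
Qed.

HB.instance Definition _ :=
  GRing.isZmodMorphism.Build (gcpZ F gT k) K gcpZ_entry gcpZ_entry_zmod.
HB.instance Definition _ :=
  GRing.isMonoidMorphism.Build (gcpZ F gT k) K gcpZ_entry gcpZ_entry_monoid.

Lemma gcpZ_entryC c : gcpZ_entry (gcpZ_const F gT k c) = constF c.
Proof. by apply: gcp_scalar_inj; rewrite -gcpZ_entryE. Qed.

Lemma gcp_alg_scalar r : gcp_alg r%:M -> r \in loopfield /\ r \in fixed gcp_act.
Proof.
move=> Rr; have E a : (r%:M : 'M[K]_N) (rk a) (rk a) = r by rewrite mxE eqxx.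
split; last first.
  by apply/fixedP => g; rewrite -{1}(E 1%g) (gcp_alg_act Rr) E.
have := gcp_alg_loopfield Rr 1%g 1%g; rewrite E mulrAC mulfV ?mul1r //.
exact: gcp_var_neq0.
Qed.

(** The center is L_G^G. For the converse inclusion, an invariant of L_G is a quotient of invariants
    p, q in [alg_orbits], and for invariants [orbit_mx] is a scalar matrix of the algebra. *)
Lemma rng_gcpZ_entry w :
  (w \in rng gcpZ_entry) = (w \in loopfield) && (w \in fixed gcp_act).
Proof.
apply/rngP/andP => [[A <-]|[wL wf]].
  have [r [c [Rr Rc c0 E]]] := gcp_center_scalar (valP A).
  suff H : gcpZ_entry A \in loopfield /\ gcpZ_entry A \in fixed gcp_act by exact: H.
  have -> : gcpZ_entry A = c^-1 * r.
    by apply: gcp_scalar_inj; rewrite -gcpZ_entryE E.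
  have [rL rf] := gcp_alg_scalar Rr; have [cL cf] := gcp_alg_scalar Rc.
  by split; apply: rpredM => //; apply: rpredVr.
have [p [q [[/alg_orbitsP Rp pf] [/alg_orbitsP Rq qf] q0 ->]]] :=
  loopfield_fixed_fracs wL wf.
rewrite (orbit_mx_fixed pf) in Rp; rewrite (orbit_mx_fixed qf) in Rq.
exists (GcpZ (gcp_centerI Rp Rq q0)); apply: gcp_scalar_inj.
by rewrite -gcpZ_entryE /= mulrC.
Qed.

End CenterOfGenericCrossedProduct.

(** * Laurent monomials of degree zero *)

Section WeightedMonomials.
Variables (W : fieldType) (D : zmodType).

(** Laurent monomials are recorded as values in [W] related to a degree, so that no exponent vectors
    are needed. *)
Inductive wmon (I : Type) (x : I -> W) (deg : I -> D) : W -> D -> Prop :=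
| wmon1 : wmon x deg 1 0
| wmonX i : wmon x deg (x i) (deg i)
| wmon_div v w c d of wmon x deg v c & wmon x deg w d : wmon x deg (v / w) (c - d).

Section Family.
Variables (I : Type) (x : I -> W) (deg : I -> D).
Hypothesis x0 : forall i, x i != 0.
Local Notation mon := (wmon x deg).

Lemma wmonV w d : mon w d -> mon w^-1 (- d).
Proof. by move=> wd; rewrite -div1r -sub0r; apply: wmon_div => //; apply: wmon1. Qed.

Lemma wmonM v w c d : mon v c -> mon w d -> mon (v * w) (c + d).
Proof.
by move=> vc wd; rewrite -[w]invrK -[d]opprK; apply: wmon_div => //; apply: wmonV.
Qed.

Lemma wmon_exprz w d (n : int) : mon w d -> mon (w ^ n) (d *~ n).
Proof.
move=> wd; have nat_case (m : nat) : mon (w ^+ m) (d *+ m).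
  by elim: m => [|m IHm]; [exact: wmon1 | rewrite exprS mulrS; apply: wmonM].
by case: n => m; [exact: nat_case | exact: (wmonV (nat_case m.+1))].
Qed.

Lemma wmon_prod (J : Type) (r : seq J) (P : pred J) (v : J -> W) (c : J -> D) :
  (forall j, P j -> mon (v j) (c j)) ->
  mon (\prod_(j <- r | P j) v j) (\sum_(j <- r | P j) c j).
Proof.
by move=> vc; elim/big_rec2: _ => [|j w d Pj]; [exact: wmon1 | apply: wmonM; apply: vc].
Qed.

Lemma wmon_neq0 w d : mon w d -> w != 0.
Proof.
elim=> [|i|v1 v2 c1 c2 _ v10 _ v20]; first exact: oner_neq0.
- exact: x0.
- by rewrite mulf_neq0 ?invr_eq0.
Qed.

Lemma wmon_fgen (S : W -> Prop) w d : (forall i, x i \in fgen S) -> mon w d -> w \in fgen S.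
Proof.
move=> xS; elim=> [|i|v1 v2 c1 c2 _ v1S _ v2S]; first exact: rpred1.
- exact: xS.
- exact: rpred_div.
Qed.

End Family.

Lemma wmon_map (I J : Type) (x : I -> W) (deg : I -> D) (x' : J -> W) (deg' : J -> D)
    (f : {rmorphism W -> W}) (h : {additive D -> D}) :
  (forall i, exists j, f (x i) = x' j /\ h (deg i) = deg' j) ->
  forall w d, wmon x deg w d -> wmon x' deg' (f w) (h d).
Proof.
move=> fh w d; elim=> [|i|v1 v2 c1 c2 _ IH1 _ IH2].
- by rewrite rmorph1 raddf0; apply: wmon1.
- by have [j [-> ->]] := fh i; apply: wmonX.
- by rewrite fmorph_div raddfB; apply: wmon_div.
Qed.

Lemma wmon_sub (I J : Type) (s : I -> J) (x : J -> W) (deg : J -> D) w d :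
  wmon (x \o s) (deg \o s) w d -> wmon x deg w d.
Proof.
elim=> [|i|v1 v2 c1 c2 _ IH1 _ IH2]; [exact: wmon1 | exact: (wmonX x deg (s i)) |].
exact: wmon_div.
Qed.

Section DegreeZero.
Variables (F : fieldType) (e : {rmorphism F -> W}).

Definition degree0 (I : Type) (x : I -> W) (deg : I -> D) : {pred W} :=
  fgen (fun w => w \in rng e \/ wmon x deg w 0).

HB.instance Definition _ (I : Type) (x : I -> W) (deg : I -> D) :=
  GRing.DivringClosed.on (degree0 x deg).

Lemma degree0_ratio (I : Type) (x : I -> W) (deg : I -> D) v w d :
  wmon x deg v d -> wmon x deg w d -> v / w \in degree0 x deg.
Proof.
by move=> vd wd; apply: mem_fgen; right; rewrite -(subrr d); apply: wmon_div.
Qed.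

Lemma degree0_sub (I J : Type) (s : I -> J) (x : J -> W) (deg : J -> D) :
  {subset degree0 (x \o s) (deg \o s) <= degree0 x deg}.
Proof.
apply: fgen_min => w [eF|w0]; apply: mem_fgen; first by left.
by right; apply: wmon_sub w0.
Qed.

Lemma degree0_act (I : Type) (x : I -> W) (deg : I -> D)
    (f : {rmorphism W -> W}) (h : {additive D -> D}) :
  (forall c, f (e c) = e c) ->
  (forall i, exists j, f (x i) = x j /\ h (deg i) = deg j) ->
  forall w, w \in degree0 x deg -> f w \in degree0 x deg.
Proof.
move=> fe fh w; apply: (@fgen_rmorph _ _ f _ (degree0 x deg)) => v [/rngP[c <-]|v0]; apply: mem_fgen.
  by left; rewrite fe mem_rng.
by right; rewrite -(raddf0 h); apply: wmon_map v0.
Qed.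

(* A Laurent monomial of degree 0 in all variables is a product of powers of
   the [x j / m j], times a Laurent monomial of degree 0 in the first block. *)
Lemma degree0_split (I J V : Type) (s : I + J -> V) (x : V -> W) (deg : V -> D)
    (m : J -> W) :
  (forall v, x v != 0) -> (forall v, exists ij, s ij = v) ->
  (forall j, wmon (x \o s \o inl) (deg \o s \o inl) (m j) (deg (s (inr j)))) ->
  degree0 x deg =i
  fgen (fun w => w \in degree0 (x \o s \o inl) (deg \o s \o inl) \/
                 exists j, w = x (s (inr j)) / m j).
Proof.
move=> x0 s_surj mdeg w; apply/idP/idP; last first.
  move: w; apply: fgen_min => w [|[j ->]]; first exact: (@degree0_sub _ _ (s \o inl) x deg).
  apply: (degree0_ratio (d := deg (s (inr j)))); first exact: wmonX.
  exact: (@wmon_sub _ _ (s \o inl) x deg _ _ (mdeg j)).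
move: w; apply: fgen_min => w [eF|w0].
  by apply: mem_fgen; left; apply: mem_fgen; left.
pose M := fgen (fun w => w \in degree0 (x \o s \o inl) (deg \o s \o inl) \/
                 exists j, w = x (s (inr j)) / m j).
have x0' i : (x \o s \o inl) i != 0 by apply: x0.
have H v d : wmon x deg v d -> exists2 v1,
    wmon (x \o s \o inl) (deg \o s \o inl) v1 d & v / v1 \in M.
  elim=> [|i|v1 v2 c1 c2 _ [w1 w1c w1M] _ [w2 w2c w2M]].
  - by exists 1; [exact: wmon1 | rewrite divr1 rpred1].
  - have [[i' <-|j <-]] := s_surj i.
      exists (x (s (inl i'))); first exact: (wmonX (x \o s \o inl) (deg \o s \o inl)).
      by rewrite divff ?rpred1.
    by exists (m j) => //; apply: mem_fgen; right; exists j.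
  - exists (w1 / w2); first exact: wmon_div.
    have -> : v1 / v2 / (w1 / w2) = (v1 / w1) / (v2 / w2).
      by rewrite !invf_div !mulf_div [v2 * w1]mulrC.
    exact: rpred_div.
have [w1 w10 ww1] := H _ _ w0; change (w \in M).
rewrite -(divfK (wmon_neq0 x0' w10) w); apply: rpredM => //.
by apply: mem_fgen; left; apply: mem_fgen; right.
Qed.

End DegreeZero.

End WeightedMonomials.

(** * Descent for fields of Laurent monomials of degree 0 *)

Section MonomialDescent.
Variables (F W : fieldType) (e : {rmorphism F -> W}).
Variables (G : finGroupType) (act : G -> {rmorphism W -> W}).
Hypothesis act1 : forall w, act 1%g w = w.
Hypothesis actM : forall g h w, act (g * h)%g w = act g (act h w).
Hypothesis actC : forall g c, act g (e c) = e c.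
Variables (V : finType) (x : V -> W) (D : zmodType) (deg : V -> D).
Hypothesis x_inj : injective (mmap e (ordfam x)).
Variables (to : G -> V -> V) (dact : G -> {additive D -> D}).
Hypothesis actX : forall g v, act g (x v) = x (to g v).
Hypothesis dactX : forall g v, dact g (deg v) = deg (to g v).
Variables (I J : finType) (s : I + J -> V).
Hypothesis s_inj : injective s.
Hypothesis s_surj : forall v, exists ij, s ij = v.
Hypothesis toI : forall g i, exists i', to g (s (inl i)) = s (inl i').
Hypothesis toJ : forall g j, exists j', to g (s (inr j)) = s (inr j').
Hypothesis degJ : forall j, exists m,
  wmon (x \o s \o inl) (deg \o s \o inl) m (deg (s (inr j))).
Local Notation L0 := (degree0 e (x \o s \o inl) (deg \o s \o inl)).
Variable theta : W.
Hypothesis L0_theta : theta \in L0.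
Hypothesis theta_free : forall g, act g theta = theta -> g = 1%g.

Lemma indep_neq0 v : x v != 0.
Proof.
rewrite -(ordfam_rank x v); apply/eqP => E.
have : ('X_(enum_rank v) : {mpoly F[#|V|]}) != 0 by rewrite -msupp_eq0 msuppX.
case/eqP; apply: x_inj.
by rewrite mmapX mmap1U E rmorph0.
Qed.

(** Apply descent to y_j = x_j / m_j, where m_j is a monomial of the first block of the same degree
    as x_j. If g maps x_j to x_{j'}, it maps y_j to y_{j'} times the ratio of m_{j'} to the
    conjugate of m_j, which has degree 0 and so lies in [L0]. *)
Lemma monomial_descent (L1 : fieldType) (e1 : {rmorphism L1 -> W}) :
  (forall w, (w \in rng e1) = (w \in L0) && (w \in fixed act)) ->
  exists phi : {rmorphism ratfun L1 #|J| -> W},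
    (forall c, phi (ratfunC L1 _ c) = e1 c) /\
    forall w, (exists y, phi y = w) <-> w \in degree0 e x deg /\ w \in fixed act.
Proof.
move=> rng_e1; have [m mdeg] := choice degJ.
have x0 := indep_neq0.
have xI0 i : (x \o s \o inl) i != 0 by apply: x0.
have m0 j : m j != 0 by apply: wmon_neq0 (mdeg j).
have L0_act g w : w \in L0 -> act g w \in L0.
  apply: (@degree0_act _ _ _ e _ _ _ (act g) (dact g)) => [c|i]; first exact: actC.
  have [i' E] := toI g i; exists i'.
  by rewrite /= actX dactX E.
have act_m g j : wmon (x \o s \o inl) (deg \o s \o inl) (act g (m j)) (deg (to g (s (inr j)))).
  rewrite -dactX; apply: (wmon_map (f := act g) (h := dact g) _ (mdeg j)) => i.
  by have [i' E] := toI g i; exists i'; rewrite /= actX dactX E.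
pose y j := (m j)^-1 * x (s (inr j)).
have xs_inj : injective (mmap e (ordfam (x \o s))) by apply: subfamily_indep.
(* Independence is proved over the larger field generated by the first block, where the m_j are
   constants. *)
pose K1 := fgen (fun w => w \in rng e \/ exists i, w = (x \o s) (inl i)).
have xK1 i : (x \o s \o inl) i \in K1 by apply: mem_fgen; right; exists i.
have y_indep : algindep L0 y.
  apply: (@algindepS _ L0 K1).
    apply: fgen_min => w [eF|w0]; first by apply: mem_fgen; left.
    exact: (wmon_fgen xK1 w0).
  apply: (@algindep_scale _ K1 _ (x \o s \o inr) (fun j => (m j)^-1)).
  - by move=> j; apply: rpredVr; apply: (wmon_fgen xK1 (mdeg j)).
  - by move=> j; rewrite invr_eq0.
  - exact: split_indep.
have y_act g j : exists c : J -> W,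
    (forall j', c j' \in L0) /\ act g (y j) = \sum_j' c j' * y j'.
  have [j' E] := toJ g j.
  exists (fun l => if l == j' then m j' / act g (m j) else 0); split=> [l|].
    case: eqP => _; last exact: rpred0.
    by apply: degree0_ratio (mdeg j') _; rewrite -E.
  rewrite (bigD1 j') //= eqxx big1 ?addr0 => [|l /negPf->]; last by rewrite mul0r.
  by rewrite /y rmorphM fmorphV actX E [RHS]mulrA [m j' / _ / _]mulrAC divff ?mul1r.
have [phi [phiC phiE]] := ratfun_descent act1 actM L0_act L0_theta theta_free y_indep y_act rng_e1.
exists phi; split=> // w; rewrite phiE; apply: and_iff_compat_r.
have -> : (w \in degree0 e x deg) =
   (w \in fgen (fun w => w \in L0 \/ exists j, w = x (s (inr j)) / m j)).
  exact: degree0_split.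
rewrite (_ : (fun v => _ \/ _) = (fun v => v \in L0 \/ exists j, v = x (s (inr j)) / m j)) //.
apply/funext => v; apply/propext; split=> -[|[j ->]]; try by left.
  by right; exists j; rewrite /y mulrC.
by right; exists j; rewrite /y mulrC.
Qed.

End MonomialDescent.

Section SameImage.
Variables (L L' W : fieldType) (f : {rmorphism L -> W}) (g : {rmorphism L' -> W}).
Hypothesis fg : forall w, (exists x, f x = w) <-> (exists x, g x = w).

Definition lift_image (h : forall w, (exists x, f x = w) <-> (exists x, g x = w))
  (x : L) : L' := projT1 (cid (proj1 (h (f x)) (ex_intro _ x erefl))).
Local Notation h := (lift_image fg).

Lemma lift_imageE x : g (h x) = f x.
Proof. by rewrite /h; case: cid. Qed.

Lemma lift_image_zmod : zmod_morphism h.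
Proof. by move=> x y; apply: (fmorph_inj g); rewrite rmorphB !lift_imageE rmorphB. Qed.

Lemma lift_image_monoid : monoid_morphism h.
Proof.
split=> [|x y]; apply: (fmorph_inj g); first by rewrite lift_imageE !rmorph1.
by rewrite rmorphM !lift_imageE rmorphM.
Qed.

HB.instance Definition _ := GRing.isZmodMorphism.Build L L' h lift_image_zmod.
HB.instance Definition _ := GRing.isMonoidMorphism.Build L L' h lift_image_monoid.

Lemma same_image_iso : exists phi : {rmorphism L -> L'},
  bijective phi /\ forall x, g (phi x) = f x.
Proof.
exists (h : {rmorphism L -> L'}); split; last exact: lift_imageE.
have /choice[k kP] y : exists x, f x = g y by apply/fg; exists y.
exists k => [x|y]; last by apply: (fmorph_inj g); rewrite lift_imageE kP.
by apply: (fmorph_inj f); rewrite kP lift_imageE.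
Qed.

End SameImage.

(** * Two families of variables with the same degree lattice *)

Section FreeLattice.
Variable J : finType.
Local Notation D := {ffun J -> int}.

Definition delta (j : J) : D := [ffun i => (i == j)%:R].

Lemma ffun_mulrzE (d : D) (n : int) j : (d *~ n) j = d j * n.
Proof.
have nat_case (m : nat) : (d *+ m) j = d j * m%:R by rewrite ffunMnE mulr_natr.
case: n => m; first by rewrite -pmulrn nat_case natz.
by rewrite NegzE mulrNz -pmulrn ffunE nat_case natz mulrN.
Qed.

Section Action.
Variables (G : finGroupType) (to : G -> J -> J).
Hypothesis to1 : forall j, to 1%g j = j.
Hypothesis toM : forall g h j, to (g * h)%g j = to g (to h j).

Definition dact_fun (t : G -> J -> J) (g : G) (d : D) : D := [ffun j => d (t g^-1%g j)].

Lemma dact_zmod g : zmod_morphism (dact_fun to g).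
Proof. by move=> c d; apply/ffunP => j; rewrite !ffunE. Qed.

HB.instance Definition _ g :=
  GRing.isZmodMorphism.Build D D (dact_fun to g) (dact_zmod g).

Definition dact g : {additive D -> D} := dact_fun to g.

Lemma dact_delta g j : dact g (delta j) = delta (to g j).
Proof.
apply/ffunP => i; rewrite !ffunE; congr (_%:R); congr nat_of_bool.
by apply/eqP/eqP => [<-|->]; rewrite -toM (mulgV, mulVg) to1.
Qed.

End Action.

Section Character.
Variables (W : fieldType) (r : J -> W).
Hypothesis r0 : forall j, r j != 0.

Definition chi (d : D) : W := \prod_j r j ^ d j.

Lemma chi_neq0 d : chi d != 0.
Proof. by apply/prodf_neq0 => j _; apply: expfz_neq0. Qed.

Lemma chiD c d : chi (c + d) = chi c * chi d.
Proof.
rewrite /chi -big_split; apply: eq_bigr => j _.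
by rewrite ffunE expfzDr.
Qed.

Lemma chi0 : chi 0 = 1.
Proof. by rewrite /chi big1 // => j _; rewrite ffunE. Qed.

Lemma chiN d : chi (- d) = (chi d)^-1.
Proof. by apply: (mulIf (chi_neq0 d)); rewrite -chiD addNr chi0 mulVf // chi_neq0. Qed.

Lemma chiB c d : chi (c - d) = chi c / chi d.
Proof. by rewrite chiD chiN. Qed.

Lemma chiMz d n : chi (d *~ n) = chi d ^ n.
Proof.
have nat_case (m : nat) : chi (d *+ m) = chi d ^+ m.
  by elim: m => [|m IHm]; rewrite ?chi0 // mulrS exprS chiD IHm.
case: n => m; first exact: nat_case.
by rewrite NegzE mulrNz chiN -pmulrn nat_case -exprnN.
Qed.

Lemma chi_sum (I : Type) (s : seq I) (P : pred I) (c : I -> D) :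
  chi (\sum_(i <- s | P i) c i) = \prod_(i <- s | P i) chi (c i).
Proof.
by elim/big_rec2: _ => [|i d w _ <-]; [exact: chi0 | exact: chiD].
Qed.

Lemma chi_delta j : chi (delta j) = r j.
Proof.
rewrite /chi (bigD1 j) //= big1 => [|i /negPf ij]; rewrite ffunE ?ij //.
by rewrite eqxx mulr1 expr1z.
Qed.

(** If each variable agrees modulo nonzero elements of [M] with the value of [chi] at its degree, so
    does each monomial; in degree 0 this value is 1. *)
Lemma wmon_chi (I : Type) (x : I -> W) (deg : I -> D) (M : divringClosed W) :
  (forall i, x i / chi (deg i) \in M) ->
  forall w, wmon x deg w 0 -> w \in M.
Proof.
move=> xM w w0; suff H v d : wmon x deg v d -> v / chi d \in M.
  by have := H _ _ w0; rewrite chi0 divr1.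
elim=> [|i|v1 v2 c1 c2 _ IH1 _ IH2]; first by rewrite chi0 divr1 rpred1.
  exact: xM.
have -> : v1 / v2 / chi (c1 - c2) = (v1 / chi c1) / (v2 / chi c2).
  by rewrite chiB !invf_div !mulf_div [v2 * _]mulrC.
exact: rpred_div.
Qed.

End Character.

End FreeLattice.

Section Image.
Variables (L W : fieldType) (f : {rmorphism L -> W}) (S : divringClosed L).

Definition rimg (f : L -> W) (S : {pred L}) : {pred W} :=
  [pred w | `[< exists2 v, v \in S & f v = w >]].

Lemma rimgP (S' : {pred L}) w : reflect (exists2 v, v \in S' & f v = w) (w \in rimg f S').
Proof. exact: asboolP. Qed.

Lemma mem_rimg v : v \in S -> f v \in rimg f S.
Proof. by move=> vS; apply/rimgP; exists v. Qed.

Lemma rimg_divring_closed : divring_closed (rimg f S).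
Proof.
split=> [|x y /rimgP[v vS <-] /rimgP[w wS <-]|x y /rimgP[v vS <-] /rimgP[w wS <-]].
- by rewrite -(rmorph1 f) mem_rimg // rpred1.
- by rewrite -rmorphB mem_rimg // rpredB.
- by rewrite -fmorph_div mem_rimg // rpred_div.
Qed.

HB.instance Definition _ :=
  GRing.isDivringClosed.Build W (rimg f S) rimg_divring_closed.

End Image.

Section Spanned.
Variables (W : fieldType) (D : zmodType) (I : Type) (x : I -> W) (deg : I -> D).

Definition spanned (d : D) : Prop := exists m, wmon x deg m d.

Lemma spannedX i : spanned (deg i).
Proof. by exists (x i); apply: wmonX. Qed.

Lemma spannedD c d : spanned c -> spanned d -> spanned (c + d).
Proof. by move=> [v vc] [w wd]; exists (v * w); apply: wmonM. Qed.

Lemma spannedB c d : spanned c -> spanned d -> spanned (c - d).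
Proof. by move=> [v vc] [w wd]; exists (v / w); apply: wmon_div. Qed.

Lemma spannedMz d n : spanned d -> spanned (d *~ n).
Proof. by move=> [w wd]; exists (w ^ n); apply: wmon_exprz. Qed.

Lemma spanned_sum (A : finType) (c : A -> D) :
  (forall a, spanned (c a)) -> spanned (\sum_a c a).
Proof. by move=> /choice[v vc]; exists (\prod_a v a); apply: wmon_prod. Qed.

End Spanned.

Lemma prod_exprz (L : fieldType) (A : finType) (f : A -> L) (n : int) :
  \prod_a f a ^ n = (\prod_a f a) ^ n.
Proof. by case: n => m; rewrite /exprz ?prodfV prodrXl. Qed.

Lemma prod_ratio (L : fieldType) (A : finType) (f : A -> L) a :
  \prod_a' (f a / f a') = f a ^+ #|A| / \prod_a' f a'.
Proof. by rewrite big_split prodr_const prodfV. Qed.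

Lemma prod_const_mul (L : fieldType) (A : finType) (p : L) (f g : A -> L) :
  \prod_a (p * f a * g a) = p ^+ #|A| * \prod_a f a * \prod_a g a.
Proof. by rewrite !big_split prodr_const. Qed.

(** The cancellation used in [chi_u] and [chi_v]: the powers of p and q disappear and s receives the
    exponent u * m + v * n = 1. *)
Lemma bezout_exprz (L : fieldType) (m n : nat) (u v : int) (p q s y : L) :
  u * m%:Z + v * n%:Z = 1 -> p != 0 -> q != 0 -> s != 0 ->
  (s ^ u) ^+ m * p ^ v * y * (q / p) ^ v * (s ^+ n / q) ^ v = s * y.
Proof.
move=> uv p0 q0 s0; rewrite !expfzMl !exprz_inv -!invr_expz.
have pv0 := expfz_neq0 v p0; have qv0 := expfz_neq0 v q0.
have -> : s * y = (s ^ u) ^+ m * ((s ^+ n) ^ v) * y.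
  by rewrite !exprnP !exprz_exp -expfzDr // [n%:Z * v]mulrC uv expr1z.
by field; rewrite ?pv0 ?qv0.
Qed.

Section LoopfieldImage.
Variables (F W : fieldType) (e : {rmorphism F -> W}) (A : finGroupType) (k : nat) (i0 : 'I_k).
Variables (I : Type) (x : I -> W) (D : zmodType) (deg : I -> D) (edge : A * A * 'I_k -> I).
Variable f : {rmorphism gcp_field F A k -> W}.
Hypothesis fC : forall c, f (ratfunC F _ c) = e c.
Hypothesis fX : forall a b i, f (gcp_var F a b i) = x (edge (a, b, i)).
Variable pot : A -> D.
Hypothesis deg_edge : forall a b i, deg (edge (a, b, i)) = pot b - pot a.

(** The degree of an edge is a difference of potentials, so it telescopes to 0 along a closed
    walk. *)
Lemma loopfield_degree0 :
  {subset rimg f (@loopfield F A k i0) <= degree0 e x deg}.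
Proof.
move=> _ /rimgP[w wL <-]; move: w wL.
move=> w; apply: (@fgen_rmorph _ _ f _ (degree0 e x deg)) => v [/rngP[c <-]|[a [b [i ->]]]].
  by rewrite fC; apply: mem_fgen; left; apply: mem_rng.
rewrite fmorph_div rmorphM !fX; apply: mem_fgen; right.
have -> : 0 = (deg (edge (1%g, a, i0)) + deg (edge (a, b, i))) - deg (edge (1%g, b, i0)).
  by rewrite !deg_edge [_ + (pot b - _)]addrC addrA subrK subrr.
by apply: wmon_div; [apply: wmonM|]; apply: wmonX.
Qed.

(** Modulo L_A an edge a -> b may be replaced by the detour a -> 1 -> b, its first step traversed
    backwards; this is the hypothesis of [wmon_chi] for edges. *)
Lemma edge_loopfield a b i :
  x (edge (a, b, i)) / (x (edge (1%g, b, i0)) / x (edge (1%g, a, i0)))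
  \in rimg f (@loopfield F A k i0).
Proof.
rewrite -!fX -!fmorph_div; apply: mem_rimg.
by rewrite invf_div mulrA [_ * gcp_var _ 1%g _ _]mulrC; apply: loopfieldX.
Qed.

End LoopfieldImage.

(** * The variables attached to G and to H, K, and their degrees *)

Section Weights.
Variables (G H K : finGroupType) (k : nat) (i0 : 'I_k).
Variables (pH : G -> H) (pK : G -> K) (pair : H -> K -> G).
Hypothesis pHM : forall g g', pH (g * g')%g = (pH g * pH g')%g.
Hypothesis pKM : forall g g', pK (g * g')%g = (pK g * pK g')%g.
Hypothesis pH_pair : forall h k, pH (pair h k) = h.
Hypothesis pK_pair : forall h k, pK (pair h k) = k.
Hypothesis pairE : forall g, pair (pH g) (pK g) = g.

(* x_{g,g',i}, u_h and v_l *)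
Definition gvars : finType := ((G * G * 'I_k) + (H + K))%type.
(* x_{h,h',i}, x_{l,l',i}, z and w_g *)
Definition hkvars : finType := (((H * H * 'I_k) + (K * K * 'I_k)) + (unit + G))%type.
Definition vars : finType := (gvars + hkvars)%type.
(** A basis of Z[H] + Z[K] + Z + Z[G], the lattice in which degrees are taken. *)
Definition weights : finType := ((H + K) + (unit + G))%type.
Local Notation D := {ffun weights -> int}.

Definition toV (g : G) (v : vars) : vars :=
  match v with
  | inl (inl (a, b, i)) => inl (inl (g * a, g * b, i)%g)
  | inl (inr (inl h)) => inl (inr (inl (pH g * h)%g))
  | inl (inr (inr l)) => inl (inr (inr (pK g * l)%g))
  | inr (inl (inl (a, b, i))) => inr (inl (inl (pH g * a, pH g * b, i)%g))
  | inr (inl (inr (a, b, i))) => inr (inl (inr (pK g * a, pK g * b, i)%g))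
  | inr (inr (inl u)) => inr (inr (inl u))
  | inr (inr (inr a)) => inr (inr (inr (g * a)%g))
  end.

Definition toD (g : G) (j : weights) : weights :=
  match j with
  | inl (inl h) => inl (inl (pH g * h)%g)
  | inl (inr l) => inl (inr (pK g * l)%g)
  | inr (inl u) => inr (inl u)
  | inr (inr a) => inr (inr (g * a)%g)
  end.

Lemma pH1 : pH 1%g = 1%g.
Proof. by apply: (mulgI (pH 1%g)); rewrite -pHM !mulg1. Qed.

Lemma pK1 : pK 1%g = 1%g.
Proof. by apply: (mulgI (pK 1%g)); rewrite -pKM !mulg1. Qed.

Lemma pairM g h l : pair (pH g * h)%g (pK g * l)%g = (g * pair h l)%g.
Proof. by rewrite -[RHS]pairE pHM pKM pH_pair pK_pair. Qed.

Lemma toV1 v : toV 1%g v = v.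
Proof.
by case: v => [[[[a b] i]|[h|l]]|[[[[a b] i]|[[a b] i]]|[u|a]]] /=; rewrite ?pH1 ?pK1 ?mul1g.
Qed.

Lemma toVM g g' v : toV (g * g')%g v = toV g (toV g' v).
Proof.
by case: v => [[[[a b] i]|[h|l]]|[[[[a b] i]|[[a b] i]]|[u|a]]] /=; rewrite ?pHM ?pKM ?mulgA.
Qed.

Lemma toD1 j : toD 1%g j = j.
Proof. by case: j => [[h|l]|[u|a]] /=; rewrite ?pH1 ?pK1 ?mul1g. Qed.

Lemma toDM g g' j : toD (g * g')%g j = toD g (toD g' j).
Proof. by case: j => [[h|l]|[u|a]] /=; rewrite ?pHM ?pKM ?mulgA. Qed.

Variables (c d : int).
Hypothesis bezout : c * #|K|%:Z + d * #|H|%:Z = 1.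

Local Notation dH h := (delta (inl (inl h) : weights)).
Local Notation dK l := (delta (inl (inr l) : weights)).
Local Notation dZ := (delta (inr (inl tt) : weights)).
Local Notation dG g := (delta (inr (inr g) : weights)).

(** Only differences of potentials are degrees of edges; in them the multiples of [dH] and [dK]
    become elements of I_H and I_K. Summed over a fibre of the projection to H or K, they yield the
    multiples c |K| and d |H| that Bezout's relation combines. *)
Definition potential (g : G) : D := dG g - dH (pH g) *~ c - dK (pK g) *~ d.

(* The degrees of the second family are the obvious generators of
   I_H + I_K + Z + Z[G]; those of the first one are the images of the generators
   of I_G + Z[H] + Z[K] under the isomorphism. *)
Definition deg (v : vars) : D :=
  match v with
  | inl (inl (a, b, _)) => potential b - potential a
  | inl (inr (inl h)) =>
      \sum_l dG (pair h l) + dZ *~ d + (\sum_h' (dH h - dH h')) *~ d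
  | inl (inr (inr l)) =>
      \sum_h dG (pair h l) - dZ *~ c + (\sum_l' (dK l - dK l')) *~ c
  | inr (inl (inl (a, b, _))) => dH b - dH a
  | inr (inl (inr (a, b, _))) => dK b - dK a
  | inr (inr (inl _)) => dZ
  | inr (inr (inr g)) => dG g
  end.

Local Notation dact := (dact toD).

Lemma dactMz g (e : D) n : dact g (e *~ n) = dact g e *~ n.
Proof. exact: raddfMz. Qed.

Lemma deg_act g v : dact g (deg v) = deg (toV g v).
Proof.
have dd := dact_delta toD1 toDM.
have dp a : dact g (potential a) = potential (g * a)%g.
  by rewrite /potential !raddfB !dactMz !dd /= pHM pKM.
have dB (e e' : D) : dact g (e - e') = dact g e - dact g e' by apply: raddfB.
have dD (e e' : D) : dact g (e + e') = dact g e + dact g e' by apply: raddfD.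
case: v => [[[[a b] i]|[h|l]]|[[[[a b] i]|[[a b] i]]|[u|a]]]; cbn [deg toV].
- by rewrite dB !dp.
- rewrite !dD !dactMz !raddf_sum dd; congr (_ + _ + _ *~ _).
    rewrite [RHS](reindex_inj (mulgI (pK g))) /=; apply: eq_bigr => l _.
    by rewrite dd /= pairM.
  rewrite [RHS](reindex_inj (mulgI (pH g))) /=; apply: eq_bigr => h' _.
  by rewrite dB !dd.
- rewrite dD dB !dactMz !raddf_sum dd; congr (_ - _ + _ *~ _).
    rewrite [RHS](reindex_inj (mulgI (pH g))) /=; apply: eq_bigr => h _.
    by rewrite dd /= pairM.
  rewrite [RHS](reindex_inj (mulgI (pK g))) /=; apply: eq_bigr => l' _.
  by rewrite dB !dd.
- by rewrite dB !dd.
- by rewrite dB !dd.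
- exact: dd.
- exact: dd.
Qed.

Section WeightsSpan.
Variables (W : fieldType) (x : vars -> W).

Lemma spanned_inl v : spanned (x \o inr) (deg \o inr) (deg (inl v)).
Proof.
have sG g : spanned (x \o inr) (deg \o inr) (dG g) by apply: (spannedX _ _ (inr (inr g))).
have sZ : spanned (x \o inr) (deg \o inr) dZ by apply: (spannedX _ _ (inr (inl tt))).
have sH h h' : spanned (x \o inr) (deg \o inr) (dH h' - dH h).
  exact: (spannedX _ _ (inl (inl (h, h', i0)))).
have sK l l' : spanned (x \o inr) (deg \o inr) (dK l' - dK l).
  exact: (spannedX _ _ (inl (inr (l, l', i0)))).
case: v => [[[a b] i]|[h|l]]; cbn [deg].
- have -> : potential b - potential a =
    (dG b - dG a) - (dH (pH b) - dH (pH a)) *~ c - (dK (pK b) - dK (pK a)) *~ d.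
    by apply/ffunP => j; rewrite !(ffunE, ffun_mulrzE); ring.
  by apply: spannedB; first apply: spannedB; try apply: spannedMz; rewrite //; apply: spannedB.
- apply: spannedD; last by apply: spannedMz; apply: spanned_sum => h'; apply: sH.
  by apply: spannedD; [apply: spanned_sum => l; apply: sG | apply: spannedMz].
- apply: spannedD; last by apply: spannedMz; apply: spanned_sum => l'; apply: sK.
  by apply: spannedB; [apply: spanned_sum => h; apply: sG | apply: spannedMz].
Qed.

(** Inserts Bezout's relation on one side of an identity of degrees, after which [ring] can prove
    it. *)
Lemma bezout_ffun (e : D) j : e j = (c * #|K|%:Z + d * #|H|%:Z) * e j.
Proof. by rewrite bezout mul1r. Qed.

Lemma sum_potential_H h h' :
  \sum_l (potential (pair h' l) - potential (pair h l)) =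
  \sum_l dG (pair h' l) - \sum_l dG (pair h l) - (dH h' - dH h) *~ (c * #|K|%:Z).
Proof.
rewrite -sumrB [_ *~ (_ * _)]mulrzA -pmulrn -sumr_const -sumrB; apply: eq_bigr => l _.
rewrite /potential !pH_pair !pK_pair; apply/ffunP => j.
by rewrite !(ffunE, ffun_mulrzE); ring.
Qed.

Lemma sum_potential_K l l' :
  \sum_h (potential (pair h l') - potential (pair h l)) =
  \sum_h dG (pair h l') - \sum_h dG (pair h l) - (dK l' - dK l) *~ (d * #|H|%:Z).
Proof.
rewrite -sumrB [_ *~ (_ * _)]mulrzA -pmulrn -sumr_const -sumrB; apply: eq_bigr => h _.
rewrite /potential !pH_pair !pK_pair; apply/ffunP => j.
by rewrite !(ffunE, ffun_mulrzE); ring.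
Qed.

Lemma sum_deltaB (A : finType) (f : A -> D) a :
  \sum_a' (f a - f a') = f a *~ #|A|%:Z - \sum_a' f a'.
Proof. by rewrite sumrB sumr_const -pmulrn. Qed.

Lemma sum_antisym (A : finType) (f : A -> D) :
  \sum_a \sum_a' (f a - f a') = 0.
Proof.
under eq_bigr => a _ do rewrite sum_deltaB -pmulrn.
by rewrite sumrB sumr_const -sumrMnl subrr.
Qed.

Lemma sum_potential_pair_H g :
  \sum_l (potential g - potential (pair (pH g) l)) =
  dG g *~ #|K|%:Z - \sum_l dG (pair (pH g) l) - (\sum_l (dK (pK g) - dK l)) *~ d.
Proof.
rewrite -pmulrn -sumr_const mulrz_suml -!sumrB; apply: eq_bigr => l _.
rewrite /potential !pH_pair !pK_pair; apply/ffunP => j.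
by rewrite !(ffunE, ffun_mulrzE); ring.
Qed.

Lemma sum_potential_pair_K g :
  \sum_h (potential g - potential (pair h (pK g))) =
  dG g *~ #|H|%:Z - \sum_h dG (pair h (pK g)) - (\sum_h (dH (pH g) - dH h)) *~ c.
Proof.
rewrite -pmulrn -sumr_const mulrz_suml -!sumrB; apply: eq_bigr => h _.
rewrite /potential !pH_pair !pK_pair; apply/ffunP => j.
by rewrite !(ffunE, ffun_mulrzE); ring.
Qed.

(** These formulas invert the lattice isomorphism: each combination of degrees of the first family
    equals c |K| + d |H| times the desired degree. *)
Lemma spanned_inr v : spanned (x \o inl) (deg \o inl) (deg (inr v)).
Proof.
have sE a b : spanned (x \o inl) (deg \o inl) (potential b - potential a).
  exact: (spannedX _ _ (inl (a, b, i0))).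
have sU h : spanned (x \o inl) (deg \o inl) (deg (inl (inr (inl h)))).
  exact: (spannedX _ _ (inr (inl h))).
have sV l : spanned (x \o inl) (deg \o inl) (deg (inl (inr (inr l)))).
  exact: (spannedX _ _ (inr (inr l))).
case: v => [[[[h h'] i]|[[l l'] i]]|[u|g]].
- have -> : deg (inr (inl (inl (h, h', i)))) =
    deg (inl (inr (inl h'))) - deg (inl (inr (inl h)))
    - \sum_l (potential (pair h' l) - potential (pair h l)).
    rewrite sum_potential_H; cbn [deg]; rewrite !(@sum_deltaB H (fun h => dH h)).
    apply/ffunP => j; rewrite bezout_ffun !(ffunE, ffun_mulrzE); ring.
  apply: spannedB; first exact: spannedB.
  by apply: spanned_sum.
- have -> : deg (inr (inl (inr (l, l', i)))) =
    deg (inl (inr (inr l'))) - deg (inl (inr (inr l)))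
    - \sum_h (potential (pair h l') - potential (pair h l)).
    rewrite sum_potential_K; cbn [deg]; rewrite !(@sum_deltaB K (fun h => dK h)).
    apply/ffunP => j; rewrite bezout_ffun !(ffunE, ffun_mulrzE); ring.
  apply: spannedB; first exact: spannedB.
  by apply: spanned_sum.
(* Both sums contain all of Z[G] once, which cancels, and the antisymmetric double sums vanish. *)
- have -> : deg (inr (inr (inl u))) =
    \sum_h deg (inl (inr (inl h))) - \sum_l deg (inl (inr (inr l))).
    cbn [deg]; rewrite !big_split /= -!mulrz_suml !sumr_const exchange_big /=.
    rewrite (sum_antisym (fun h => dH h)) (sum_antisym (fun l => dK l)).
    apply/ffunP => j; rewrite bezout_ffun !(ffunE, ffun_mulrzE, pmulrn); ring.
  by apply: spannedB; apply: spanned_sum.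
(* The terms c d [dZ] cancel; the two sums of potentials remove the fibre sums and the parts in I_H
   and I_K. *)
- have -> : deg (inr (inr (inr g))) =
    deg (inl (inr (inl (pH g)))) *~ c + deg (inl (inr (inr (pK g)))) *~ d
    + (\sum_l (potential g - potential (pair (pH g) l))) *~ c
    + (\sum_h (potential g - potential (pair h (pK g)))) *~ d.
    rewrite sum_potential_pair_H sum_potential_pair_K; cbn [deg].
    apply/ffunP => j; rewrite bezout_ffun !(ffunE, ffun_mulrzE); ring.
  do 3?apply: spannedD; try apply: spannedMz; rewrite //; exact: spanned_sum.
Qed.

End WeightsSpan.

Section WeightsField.
Variables (F W : fieldType) (e : {rmorphism F -> W}) (x : vars -> W).
Hypothesis x0 : forall v, x v != 0.
Variables (fG : {rmorphism gcp_field F G k -> W}) (fH : {rmorphism gcp_field F H k -> W}).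
Variable fK : {rmorphism gcp_field F K k -> W}.
Hypothesis fGC : forall a, fG (ratfunC F _ a) = e a.
Hypothesis fHC : forall a, fH (ratfunC F _ a) = e a.
Hypothesis fKC : forall a, fK (ratfunC F _ a) = e a.
Hypothesis fGX : forall a b i, fG (gcp_var F a b i) = x (inl (inl (a, b, i))).
Hypothesis fHX : forall a b i, fH (gcp_var F a b i) = x (inr (inl (inl (a, b, i)))).
Hypothesis fKX : forall a b i, fK (gcp_var F a b i) = x (inr (inl (inr (a, b, i)))).

Local Notation xG g := (x (inl (inl (1%g, g, i0)))).

(** Up to a summand independent of h, the degree of [RH h] is [dH h]: subtracting the potentials
    over the fibre of h adds the missing c |K| [dH h] to d |H| [dH h]. Likewise for [RK l] and
    [dK l]. *)
Let RH h := x (inl (inr (inl h))) / \prod_l xG (pair h l).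
Let RK l := x (inl (inr (inr l))) / \prod_h xG (pair h l).

(* [r] gives a monomial of the first family for each basis vector, in such a
   way that [chi r (deg v)] has degree [deg v] for all variables [v] of that
   family. *)
Let r (j : weights) : W :=
  match j with
  | inl (inl h) => RH h
  | inl (inr l) => RK l
  | inr (inl _) => (\prod_h RH h) / (\prod_l RK l)
  | inr (inr g) => RH (pH g) ^ c * RK (pK g) ^ d * xG g
  end.

Let RH0 h : RH h != 0.
Proof. by apply: mulf_neq0; rewrite ?invr_eq0 //; apply/prodf_neq0. Qed.

Let RK0 l : RK l != 0.
Proof. by apply: mulf_neq0; rewrite ?invr_eq0 //; apply/prodf_neq0. Qed.

Let r0 j : r j != 0.
Proof.
case: j => [[h|l]|[u|g]] //=.
  by apply: mulf_neq0; rewrite ?invr_eq0; apply/prodf_neq0.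
by rewrite !mulf_neq0 ?expfz_neq0.
Qed.

Let chi_potential g : chi r (potential g) = xG g.
Proof.
rewrite /potential !chiB // !chiMz // !chi_delta /=.
have := expfz_neq0 d (RK0 (pK g)); have := expfz_neq0 c (RH0 (pH g)).
move: (_ ^ c) (_ ^ d) => p q p0 q0.
by field; rewrite p0 q0.
Qed.

Let chi_u h : chi r (deg (inl (inr (inl h)))) = x (inl (inr (inl h))).
Proof.
cbn [deg]; rewrite !chiD // !chiMz // !chi_sum // !chi_delta.
under eq_bigr => l _ do rewrite chi_delta /r pH_pair pK_pair.
under [X in _ * X ^ _]eq_bigr => h' _ do rewrite chiB // !chi_delta /=.
rewrite (prod_ratio RH) prod_const_mul prod_exprz bezout_exprz //.
- by rewrite divfK //; apply/prodf_neq0.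
- by apply/prodf_neq0.
- by apply/prodf_neq0.
Qed.

Let chi_v l : chi r (deg (inl (inr (inr l)))) = x (inl (inr (inr l))).
Proof.
cbn [deg]; rewrite !chiD // chiN // !chiMz // !chi_sum // !chi_delta.
under eq_bigr => h _ do rewrite chi_delta /r pH_pair pK_pair [_ ^ c * _]mulrC.
under [X in _ * X ^ _]eq_bigr => l' _ do rewrite chiB // !chi_delta /=.
rewrite (prod_ratio RK) prod_const_mul prod_exprz invr_expz -exprz_inv invf_div.
rewrite bezout_exprz //.
- by rewrite divfK //; apply/prodf_neq0.
- by rewrite addrC.
- by apply/prodf_neq0.
- by apply/prodf_neq0.
Qed.

(** Since [chi r] takes the degrees of u_h and v_l to u_h and v_l exactly, these variables
    contribute nothing beyond L_G to the monomials of degree 0. *)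
Lemma degree0_inl :
  degree0 e (x \o inl) (deg \o inl) =i rimg fG (@loopfield F G k i0).
Proof.
move=> w; apply/idP/idP; last first.
  move: w; apply: (@loopfield_degree0 _ _ _ _ _ _ _ _ _ _ (fun t => inl t) _ fGC fGX potential).
  by [].
move: w; apply: fgen_min => w [/rngP[a <-]|w0].
  by rewrite -fGC; apply: mem_rimg; apply: loopfield_const.
apply: (wmon_chi (r := r) (M := rimg fG (@loopfield F G k i0)) r0 _ w0).
move=> [[[a b] i]|[h|l]].
- rewrite [chi _ _](_ : _ = xG b / xG a); last first.
    by rewrite -!chi_potential -chiB.
  exact: (@edge_loopfield _ _ _ _ i0 _ (x \o inl) (fun t => inl t) _ fGX).
- by rewrite [chi _ _]chi_u divff ?rpred1 //; apply: x0.
- by rewrite [chi _ _]chi_v divff ?rpred1 //; apply: x0.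
Qed.

Lemma loopfieldH_degree0 :
  {subset rimg fH (@loopfield F H k i0) <= degree0 e (x \o inr) (deg \o inr)}.
Proof.
apply: (@loopfield_degree0 _ _ _ _ _ _ _ _ _ _ (fun t => inl (inl t)) _ fHC fHX (fun h => dH h)).
by [].
Qed.

Lemma loopfieldK_degree0 :
  {subset rimg fK (@loopfield F K k i0) <= degree0 e (x \o inr) (deg \o inr)}.
Proof.
apply: (@loopfield_degree0 _ _ _ _ _ _ _ _ _ _ (fun t => inl (inr t)) _ fKC fKX (fun l => dK l)).
by [].
Qed.

Let r' (j : weights) : W :=
  match j with
  | inl (inl h) => x (inr (inl (inl (1%g, h, i0))))
  | inl (inr l) => x (inr (inl (inr (1%g, l, i0))))
  | inr (inl _) => x (inr (inr (inl tt)))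
  | inr (inr g) => x (inr (inr (inr g)))
  end.

(** The argument of [degree0_inl] with the evident values [r'] on the basis; here z and w_g are the
    variables that contribute nothing, and L_H L_K remains. *)
Lemma degree0_inr (M : divringClosed W) :
  {subset rimg fH (@loopfield F H k i0) <= M} ->
  {subset rimg fK (@loopfield F K k i0) <= M} ->
  {subset degree0 e (x \o inr) (deg \o inr) <= M}.
Proof.
move=> HM KM; have r0' j : r' j != 0 by case: j => [[h|l]|[u|g]] /=.
apply: fgen_min => w [/rngP[a <-]|w0].
  by rewrite -fHC; apply: HM; apply: mem_rimg; apply: loopfield_const.
apply: (wmon_chi r0' _ w0).
move=> [[[[a b] i]|[[a b] i]]|[[]|g]].
- rewrite [chi _ _](_ : _ = r' (inl (inl b)) / r' (inl (inl a))); last first.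
    by rewrite -!chi_delta -chiB.
  by apply: HM; apply: (@edge_loopfield _ _ _ _ i0 _ (x \o inr) (fun t => inl (inl t)) _ fHX).
- rewrite [chi _ _](_ : _ = r' (inl (inr b)) / r' (inl (inr a))); last first.
    by rewrite -!chi_delta -chiB.
  by apply: KM; apply: (@edge_loopfield _ _ _ _ i0 _ (x \o inr) (fun t => inl (inr t)) _ fKX).
- by rewrite [chi _ _]chi_delta divff ?rpred1 //; apply: x0.
- by rewrite [chi _ _]chi_delta divff ?rpred1 //; apply: x0.
Qed.

End WeightsField.

End Weights.

(** * The tensor product as a subring of a field *)

Section Compositum.
Variables (F A B W : fieldType) (e : {rmorphism F -> W}).
Variables (iA : {rmorphism F -> A}) (iB : {rmorphism F -> B}).
Variables (fA : {rmorphism A -> W}) (fB : {rmorphism B -> W}).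
Hypothesis fiA : forall c, fA (iA c) = e c.
Hypothesis fiB : forall c, fB (iB c) = e c.

Definition prodsum (fA : A -> W) (fB : B -> W) (s : seq (A * B)) : W :=
  \sum_(ab <- s) fA ab.1 * fB ab.2.

(** The image in [W] of the tensor product of A and B over F. *)
Definition compos (fA : A -> W) (fB : B -> W) : {pred W} :=
  [pred w | `[< exists s, prodsum fA fB s = w >]].

Lemma composP w : reflect (exists s, prodsum fA fB s = w) (w \in compos fA fB).
Proof. exact: asboolP. Qed.

Lemma compos_prod a b : fA a * fB b \in compos fA fB.
Proof. by apply/composP; exists [:: (a, b)]; rewrite /prodsum big_seq1. Qed.

Lemma compos_subring_closed : subring_closed (compos fA fB).
Proof.
have opp s : prodsum fA fB [seq (- ab.1, ab.2) | ab <- s] = - prodsum fA fB s.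
  by rewrite /prodsum big_map -sumrN; apply: eq_bigr => ab _; rewrite rmorphN mulNr.
split=> [|x y /composP[s <-] /composP[s' <-]|x y /composP[s <-] /composP[s' <-]].
- by have := compos_prod 1 1; rewrite !rmorph1 mulr1.
- apply/composP; exists (s ++ [seq (- ab.1, ab.2) | ab <- s']).
  by rewrite /prodsum big_cat /= -!/(prodsum _ _ _) opp.
- apply/composP; exists [seq (ab.1 * ab'.1, ab.2 * ab'.2) | ab <- s, ab' <- s'].
  rewrite /prodsum big_allpairs_dep mulr_suml; apply: eq_bigr => ab _.
  rewrite mulr_sumr; apply: eq_bigr => ab' _.
  by rewrite !rmorphM mulrACA.
Qed.

HB.instance Definition _ :=
  GRing.isSubringClosed.Build W (compos fA fB) compos_subring_closed.

Record comps : Type := Comps {comps_val :> W; _ : comps_val \in compos fA fB}.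

HB.instance Definition _ := [isSub for comps_val].
HB.instance Definition _ := [Choice of comps by <:].
HB.instance Definition _ := [SubChoice_isSubComNzRing of comps by <:].

Definition comps_unit : {pred comps} := [pred x | `[< exists y : comps, y * x = 1 >]].

Definition comps_inv (x : comps) : comps :=
  if pselect (exists y : comps, y * x = 1) is left E then projT1 (cid E) else x.

Lemma comps_mulVx : {in comps_unit, left_inverse 1 comps_inv *%R}.
Proof.
by move=> x /asboolP ux; rewrite /comps_inv; case: pselect => // E; case: cid.
Qed.

Lemma comps_unitPl (x y : comps) : y * x = 1 -> x \in comps_unit.
Proof. by move=> yx; apply/asboolP; exists y. Qed.

Lemma comps_inv_out : {in [predC comps_unit], comps_inv =1 id}.
Proof.
by move=> x /asboolP ux; rewrite /comps_inv; case: pselect.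
Qed.

HB.instance Definition _ :=
  GRing.ComNzRing_hasMulInverse.Build comps comps_mulVx comps_unitPl comps_inv_out.

Lemma comps_integral : GRing.integral_domain_axiom comps.
Proof.
move=> x y /(congr1 val) /eqP; rewrite rmorphM rmorph0 mulf_eq0.
by rewrite -!(inj_eq val_inj) !rmorph0.
Qed.

HB.instance Definition _ := GRing.ComUnitRing_isIntegral.Build comps comps_integral.

Lemma compsC_subproof c : e c \in compos fA fB.
Proof. by rewrite -[e c]mulr1 -fiA -(rmorph1 fB) compos_prod. Qed.

Definition compsC_fun c : comps := Comps (compsC_subproof c).

Lemma compsC_zmod : zmod_morphism compsC_fun.
Proof. by move=> c d; apply: val_inj; rewrite rmorphB /= rmorphB. Qed.

Lemma compsC_monoid : monoid_morphism compsC_fun.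
Proof.
by split=> [|c d]; apply: val_inj; rewrite ?rmorph1 ?rmorphM /= ?rmorph1 ?rmorphM.
Qed.

HB.instance Definition _ := GRing.isZmodMorphism.Build F comps compsC_fun compsC_zmod.
HB.instance Definition _ := GRing.isMonoidMorphism.Build F comps compsC_fun compsC_monoid.

Definition compsC : {rmorphism F -> comps} := compsC_fun.

Definition comps_mk a b : comps := Comps (compos_prod a b).

(** Linear disjointness: elements of B that become dependent over A are already dependent over F. *)
Hypothesis lin_disj : forall n (a : 'I_n -> A) (b : 'I_n -> B),
  \sum_i fA (a i) * fB (b i) = 0 -> (exists i, a i != 0) ->
  exists2 c : 'I_n -> F, (exists i, c i != 0) & \sum_i iB (c i) * b i = 0.

(* Induction on the number of terms: a linear relation over F between the b_i
   allows one to eliminate one of them. *)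
Lemma bilinear_vanish (V : lmodType F) (f : A -> B -> V) :
  F_bilinear iA iB *:%R f -> forall n (a : 'I_n -> A) (b : 'I_n -> B),
  \sum_i fA (a i) * fB (b i) = 0 -> \sum_i f (a i) (b i) = 0.
Proof.
move=> [fDl fDr fZl fZr].
have f0 b : f 0 b = 0 by have := fZl 0 0 b; rewrite rmorph0 mul0r scale0r.
have f0r a : f a 0 = 0 by have := fZr 0 a 0; rewrite rmorph0 mul0r scale0r.
have fsum a n (b : 'I_n -> B) : f a (\sum_i b i) = \sum_i f a (b i).
  by apply: (big_morph (f a)).
elim=> [|n IHn] a b ab0; first by rewrite big_ord0.
have [/existsP[i0 ai0]|] := boolP [exists i, a i != 0]; last first.
  rewrite negb_exists => /forallP a0; rewrite big1 // => i _.
  by have := a0 i; rewrite negbK => /eqP ->.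
have [|c [j cj] cb0] := lin_disj ab0; first by exists i0.
pose u i := - (c i / c j).
have bj : b j = \sum_(i < n) iB (u (lift j i)) * b (lift j i).
  have cj' : iB (c j) != 0 by rewrite fmorph_eq0.
  apply: (mulfI cj'); rewrite mulr_sumr; apply/eqP; rewrite -subr_eq0; apply/eqP.
  rewrite -[RHS]cb0 (bigD1_ord j) //= -sumrN; congr (_ + _); apply: eq_bigr => i _.
  by rewrite mulrA -rmorphM /u mulrN [c j * _]mulrC divfK // rmorphN mulNr opprK.
have fj : f (a j) (b j) = \sum_(i < n) f (iA (u (lift j i)) * a j) (b (lift j i)).
  by rewrite bj fsum; apply: eq_bigr => i _; rewrite fZl fZr.
rewrite (bigD1_ord j) //= fj -big_split /=.
under eq_bigr => i _ do rewrite -fDl.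
apply: IHn; rewrite -[RHS]ab0 (bigD1_ord j) //= bj rmorph_sum mulr_sumr -big_split.
apply: eq_bigr => i _; rewrite rmorphD mulrDl; congr (_ + _).
by rewrite !rmorphM fiA fiB mulrCA mulrA.
Qed.

Lemma bilinear_prodsum (V : lmodType F) (f : A -> B -> V) :
  F_bilinear iA iB *:%R f -> forall s s', prodsum fA fB s = prodsum fA fB s' ->
  \sum_(ab <- s) f ab.1 ab.2 = \sum_(ab <- s') f ab.1 ab.2.
Proof.
move=> fbil s s' ss'; have [fDl _ fZl _] := fbil.
have fN a b : f (- a) b = - f a b.
  by have := fZl (-1) a b; rewrite rmorphN1 mulN1r scaleN1r.
pose s2 := s ++ [seq (- ab.1, ab.2) | ab <- s'].
suff : \sum_(ab <- s2) f ab.1 ab.2 = 0.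
  rewrite big_cat big_map /=; under [X in _ + X]eq_bigr => ab _ do rewrite fN.
  by rewrite sumrN => /eqP; rewrite subr_eq0 => /eqP.
have s20 : prodsum fA fB s2 = 0.
  rewrite /prodsum big_cat big_map /=.
  under [X in _ + X]eq_bigr => ab _ do rewrite rmorphN mulNr.
  by rewrite sumrN; apply/eqP; rewrite subr_eq0; apply/eqP.
rewrite (big_nth (0, 0)) big_mkord.
apply: (@bilinear_vanish _ f fbil _ (fun i => (nth (0, 0) s2 i).1) (fun i => (nth (0, 0) s2 i).2)).
by rewrite -[RHS]s20 /prodsum (big_nth (0, 0)) big_mkord.
Qed.

Lemma comps_sum (w : comps) : exists s : seq (A * B),
  w = \sum_(ab <- s) comps_mk ab.1 ab.2.
Proof.
have /composP[s Es] := valP w; exists s; apply: val_inj.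
by rewrite rmorph_sum -[LHS]Es.
Qed.

Lemma comps_tensor : is_tensor_product iA iB compsC comps_mk.
Proof.
split.
- split=> *; apply: val_inj; rewrite ?rmorphD ?rmorphM /= ?rmorphD ?rmorphM ?fiA ?fiB.
  + by rewrite mulrDl.
  + by rewrite mulrDr.
  + by rewrite mulrA.
  + by rewrite mulrCA.
- move=> V f fbil; have [fDl fDr fZl fZr] := fbil.
  have /choice[rep repE] (w : comps) : exists s, prodsum fA fB s = val w.
    by apply/composP; apply: valP.
  (* The value does not depend on the chosen representation of w, by [bilinear_prodsum]. *)
  pose g (w : comps) : V := \sum_(ab <- rep w) f ab.1 ab.2.
  have gE w s : prodsum fA fB s = val w -> g w = \sum_(ab <- s) f ab.1 ab.2.
    by move=> sw; apply: bilinear_prodsum => //; rewrite repE.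
  exists g; split.
  + split=> [v w|c w].
      rewrite (gE (v + w) (rep v ++ rep w)) ?big_cat //.
      by rewrite /prodsum big_cat /= -!/(prodsum _ _ _) !repE.
    rewrite (gE _ [seq (iA c * ab.1, ab.2) | ab <- rep w]).
      by rewrite big_map scaler_sumr; apply: eq_bigr => ab _; rewrite fZl.
    rewrite /prodsum big_map rmorphM /= -repE /prodsum mulr_sumr.
    by apply: eq_bigr => ab _; rewrite rmorphM fiA mulrA.
  + by move=> a b; rewrite (gE _ [:: (a, b)]) /prodsum ?big_seq1.
  + move=> g' [g'D g'Z] g't w; have [s ->] := comps_sum w.
    have g'0 : g' 0 = 0 by have := g'Z 0 0; rewrite rmorph0 mul0r scale0r.
    rewrite (big_morph _ g'D g'0) (gE _ s).
      by apply: eq_bigr => ab _; rewrite g't.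
    by rewrite rmorph_sum.
- by apply: val_inj; rewrite rmorph1 /= !rmorph1 mulr1.
- by move=> a a' b b'; apply: val_inj; rewrite rmorphM /= !rmorphM mulrACA.
Qed.

Definition comps_incl : {rmorphism comps -> W} := val.

Lemma comps_incl_inj : injective comps_incl.
Proof. exact: val_inj. Qed.

Lemma rng_comps_frac w :
  (w \in rng (frac_lift comps_incl_inj)) = (w \in fracs (compos fA fB)).
Proof.
apply/rngP/fracsP => [[x <-]|[p [q [pT qT q0 ->]]]].
  have [[n d] /= [d0 ->]] := fractionE x; exists (val n), (val d).
  rewrite fmorph_div !frac_liftE; split=> //; exact: valP.
exists (tofrac (Comps pT) / tofrac (Comps qT)).
by rewrite fmorph_div !frac_liftE.
Qed.

End Compositum.

(** After clearing denominators the b_i are polynomials q_i over F. By independence a is in the left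
    kernel of their coefficient matrix; rank is unchanged by extending F to [W], so this kernel has
    a nonzero vector over F. *)
Lemma ratfun_linear_disjoint (F W : fieldType) (e : {rmorphism F -> W}) (I : finType)
    (y : I -> W) (S : divringClosed W) (f : {rmorphism ratfun F #|I| -> W}) n
    (a : 'I_n -> W) (b : 'I_n -> ratfun F #|I|) :
  (forall c, f (ratfunC F _ c) = e c) -> (forall i, f (rvar F i) = y i) ->
  (forall c, e c \in S) -> algindep S y -> (forall i, a i \in S) ->
  \sum_i a i * f (b i) = 0 -> (exists i, a i != 0) ->
  exists2 c : 'I_n -> F, (exists i, c i != 0) & \sum_i ratfunC F _ (c i) * b i = 0.
Proof.
move=> fC fX eS y_indep aS ab0 [i0 ai0].
have [|d [Rd d0] db] :=
  @fracs_common_denom _ (rng (@tofrac {mpoly F[#|I|]})) [seq b i | i <- enum 'I_n].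
  move=> _ /mapP[i _ ->]; have [[p q] /= [q0 ->]] := fractionE (b i).
  apply/fracsP; exists (tofrac p), (tofrac q); split; try exact: mem_rng; last by [].
  by rewrite tofrac_eq0.
have /choice[q Eq] i : exists q, tofrac q = d * b i.
  by apply/rngP; apply: db; apply: map_f; rewrite mem_enum.
have fq p : f (tofrac p) = (map_mpoly e p).@[ordfam y].
  move: p; apply: (@mpoly_rmorph_ext _ _ _ (f \o @tofrac {mpoly F[#|I|]})
                    (meval (ordfam y) \o map_mpoly e)) => [c|i] /=.
    by rewrite -ratfunCE fC map_mpolyC mevalC.
  by rewrite -ratfunXE map_mpolyX mevalXU ordfamE -fX rvarE enum_valK.
pose P := \sum_i a i *: map_mpoly e (q i).
have P0 : P = 0.
  apply: y_indep.
    rewrite rpred_sum // => i _; rewrite mpolyOverZ //.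
    apply/mpolyOverP => m; rewrite mcoeff_map_mpoly; exact: eS.
  rewrite rmorph_sum; transitivity (f d * \sum_i a i * f (b i)).
    rewrite mulr_sumr; apply: eq_bigr => i _ /=.
    by rewrite mevalZ -fq Eq rmorphM mulrCA.
  by rewrite ab0 mulr0.
(* All exponents occurring in some q_i; at any other exponent every coefficient is 0. *)
pose M := flatten [seq (msupp (q i) : seq _) | i <- enum 'I_n].
pose Q : 'M[F]_(n, size M) := \matrix_(i, j) (q i)@_(nth 0%MM M j).
have Q_dep : ~~ row_free Q.
  apply: contraTN isT => Q_free.
  have : (\row_i a i) *m map_mx e Q = 0.
    apply/rowP => j; rewrite !mxE; transitivity (P@_(nth 0%MM M j)); last first.
      by rewrite P0 mcoeff0.
    rewrite raddf_sum /=; apply: eq_bigr => i _.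
    by rewrite !mxE mcoeffZ mcoeff_map_mpoly.
  have eQ_free : row_free (map_mx e Q) by rewrite /row_free mxrank_map.
  move=> /eqP; rewrite (mulmx_free_eq0 _ eQ_free) => /eqP/rowP/(_ i0).
  by rewrite !mxE => /eqP; rewrite (negPf ai0).
rewrite -kermx_eq0 in Q_dep; have /rowV0Pn[c /sub_kermxP cQ c0] := Q_dep.
exists (fun i => c 0 i).
  have /existsP[i ci] : [exists i, c 0 i != 0]; last by exists i.
  apply: contraNT c0; rewrite negb_exists => /forallP c0.
  by apply/eqP/rowP => i; have := c0 i; rewrite negbK mxE => /eqP.
apply: (mulfI d0); rewrite mulr0 mulr_sumr.
have cq0 : \sum_i c 0 i *: q i = 0.
  apply/mpolyP => m; rewrite mcoeff0 raddf_sum /=.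
  have [mM|mM] := boolP (m \in M).
    have /rowP/(_ (Ordinal (etrans (index_mem m M) mM))) := cQ.
    rewrite !mxE => E; rewrite -[RHS]E; apply: eq_bigr => i _.
    by rewrite mcoeffZ !mxE /= nth_index.
  rewrite big1 // => i _; rewrite mcoeffZ memN_msupp_eq0 ?mulr0 //.
  apply: contra mM => mq; apply/flattenP; exists (msupp (q i)) => //.
  by apply/mapP; exists i; rewrite ?mem_enum.
transitivity (tofrac (\sum_i c 0 i *: q i)); last by rewrite cq0 rmorph0.
rewrite rmorph_sum; apply: eq_bigr => i _.
by rewrite mulrCA -Eq ratfunCE -rmorphM mul_mpolyC.
Qed.

(** * Invariants of the field generated by two subfields *)

Section SumProducts.
Variables (W : fieldType) (S S' : divringClosed W).

Definition sumprods (S S' : {pred W}) : {pred W} :=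
  [pred w | `[< exists s : seq (W * W),
     (forall ab, ab \in s -> ab.1 \in S /\ ab.2 \in S') /\
     w = \sum_(ab <- s) ab.1 * ab.2 >]].

Lemma sumprodsP (T T' : {pred W}) w :
  reflect (exists s : seq (W * W), (forall ab, ab \in s -> ab.1 \in T /\ ab.2 \in T') /\
     w = \sum_(ab <- s) ab.1 * ab.2) (w \in sumprods T T').
Proof. exact: asboolP. Qed.

Lemma sumprods_mul a b : a \in S -> b \in S' -> a * b \in sumprods S S'.
Proof.
move=> aS bS; apply/sumprodsP; exists [:: (a, b)]; rewrite big_seq1; split=> // ab.
by rewrite inE => /eqP ->.
Qed.

Lemma sumprods_subring : subring_closed (sumprods S S').
Proof.
split=> [|x y /sumprodsP[s [sS ->]] /sumprodsP[t [tS ->]]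
         |x y /sumprodsP[s [sS ->]] /sumprodsP[t [tS ->]]].
- by rewrite -[1]mulr1; apply: sumprods_mul; apply: rpred1.
- apply/sumprodsP; exists (s ++ [seq (- ab.1, ab.2) | ab <- t]); split=> [ab|].
    rewrite mem_cat => /orP[/sS //|/mapP[cd /tS[cS dS] ->]].
    by rewrite rpredN.
  rewrite big_cat big_map -sumrN; congr (_ + _); apply: eq_bigr => ab _.
  by rewrite mulNr.
- apply/sumprodsP; exists [seq (ab.1 * cd.1, ab.2 * cd.2) | ab <- s, cd <- t].
  split=> [ab /allpairsP[[u v] /= [/sS[? ?] /tS[? ?] ->]]|].
    by rewrite !rpredM.
  rewrite big_allpairs_dep mulr_suml; apply: eq_bigr => ab _.
  by rewrite mulr_sumr; apply: eq_bigr => cd _; rewrite mulrACA.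
Qed.

HB.instance Definition _ :=
  GRing.isSubringClosed.Build W (sumprods S S') sumprods_subring.

Variables (A B : fieldType) (fA : {rmorphism A -> W}) (fB : {rmorphism B -> W}).
Variables (G : finGroupType) (act : G -> {rmorphism W -> W}).
Hypothesis act1 : forall w, act 1%g w = w.
Hypothesis actM : forall g h w, act (g * h)%g w = act g (act h w).
Hypothesis actS : forall g a, a \in S -> act g a \in S.
Hypothesis actS' : forall g a, a \in S' -> act g a \in S'.
Hypothesis cardG : #|G|%:R != 0 :> A.
Hypothesis trace_mul : forall a b, a \in S -> b \in S' ->
  \sum_g act g a * act g b \in compos fA fB.

(** Averaging: |G| w is the sum of the conjugates of w, hence a sum of traces of products, and |G|
    is invertible. *)
Lemma fixed_sumprods w : w \in sumprods S S' -> w \in fixed act ->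
  w \in compos fA fB.
Proof.
move=> /sumprodsP[s [sS Ew]] /fixedP wf.
have Gw : w *+ #|G| \in compos fA fB.
  have -> : w *+ #|G| = \sum_(ab <- s) \sum_g act g ab.1 * act g ab.2.
    rewrite exchange_big /= -sumr_const; apply: eq_bigr => g _.
    by rewrite -(wf g) {1}Ew rmorph_sum; apply: eq_bigr => ab _; rewrite rmorphM.
  by rewrite big_seq rpred_sum // => ab /sS[aS bS]; apply: trace_mul.
have G0 : #|G|%:R != 0 :> W by rewrite -(rmorph_nat fA) fmorph_eq0.
have -> : w = (fA (#|G|%:R)^-1 * fB 1) * (w *+ #|G|).
  by rewrite rmorph1 mulr1 fmorphV rmorph_nat -[w *+ _]mulr_natl mulKf.
by apply: rpredM => //; apply: compos_prod.
Qed.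

(** Norms of denominators reduce an invariant of the field to a quotient of invariants of the ring S
    S', to which averaging applies. *)
Lemma fixed_fgen_sumprods (M : divringClosed W) :
  {subset S <= M} -> {subset S' <= M} ->
  {subset M <= fgen (fun w => w \in S \/ w \in S')} ->
  {subset rng fA <= S} -> {subset rng fB <= S'} ->
  {subset rng fA <= fixed act} -> {subset rng fB <= fixed act} ->
  forall w, (w \in fracs (compos fA fB)) = (w \in M) && (w \in fixed act).
Proof.
move=> SM SM' MS AS BS Af Bf w; apply/idP/andP => [|[wM wf]].
  move=> wT; split; move: w wT.
    apply: (@fracs_min _ _ M) => w /composP[s <-]; apply: rpred_sum => ab _.
    by apply: rpredM; [apply/SM/AS/mem_rng | apply/SM'/BS/mem_rng].
  apply: (@fracs_min _ _ (fixed act)) => w /composP[s <-]; apply: rpred_sum => ab _.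
  by apply: rpredM; [apply/Af/mem_rng | apply/Bf/mem_rng].
have wR : w \in fracs (sumprods S S').
  have sub : {subset fgen (fun w => w \in S \/ w \in S') <= fracs (sumprods S S')}.
    apply: fgen_min => v [vS|vS']; apply: sub_fracs.
      by rewrite -[v]mulr1; apply: sumprods_mul => //; apply: rpred1.
    by rewrite -[v]mul1r; apply: sumprods_mul => //; apply: rpred1.
  exact/sub/MS.
have [|p [q [[pR pf] [qR qf] q0 ->]]] := @fixed_fracs _ _ _ act1 actM (sumprods S S') _ w wf wR.
  move=> g _ /sumprodsP[s [sS ->]]; rewrite rmorph_sum big_seq; apply: rpred_sum => ab /sS[aS bS].
  by rewrite rmorphM; apply: sumprods_mul; [apply: actS | apply: actS'].
by apply/fracsP; exists p, q; split=> //; apply: fixed_sumprods.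
Qed.

End SumProducts.

Lemma ratfun_image (F W : fieldType) (I : finType) (f : {rmorphism ratfun F #|I| -> W})
    (T : divringClosed W) :
  (forall c, f (ratfunC F _ c) \in T) -> (forall i, f (rvar F i) \in T) ->
  forall w, f w \in T.
Proof.
move=> fC fX w; have [[p q] /= [q0 ->]] := fractionE w.
have fT r : f (tofrac r) \in T.
  rewrite -ratfun_mmapE /mmap rmorph_sum; apply: rpred_sum => m _.
  rewrite rmorphM; apply: rpredM; first exact: fC.
  rewrite rmorph_prod; apply: rpred_prod => i _; rewrite rmorphXn; apply: rpredX.
  by rewrite -[i]enum_valK -rvarE; apply: fX.
by rewrite fmorph_div; apply: rpred_div; apply: fT.
Qed.

(** * Stable isomorphism *)

Section IndependentVariables.
Variables (F W : fieldType) (e : {rmorphism F -> W}) (I : finType) (x : I -> W).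
Hypothesis x_inj : injective (mmap e (ordfam x)).

Lemma indep_inj : injective x.
Proof.
move=> i j E; have : 'X_(enum_rank i) = 'X_(enum_rank j) :> {mpoly F[#|I|]}.
  by apply: x_inj; rewrite !mmapX !mmap1U !ordfam_rank.
move=> /(congr1 (fun p => p@_U_(enum_rank j))) /eqP.
rewrite !mcoeffXU eqxx; case: (enum_rank i =P enum_rank j) => [/enum_rank_inj //|_].
by rewrite eq_sym oner_eq0.
Qed.

(** Compare the exponents of x_a on both sides. This determines the stabilizer of a product of two
    variables in [descent_HK]. *)
Lemma indep_mul_inj a b c d : x a * x b = x c * x d -> a != d -> a != b -> a = c.
Proof.
move=> E ad ab; pose X i : {mpoly F[#|I|]} := 'X_(enum_rank i).
have : X a * X b = X c * X d.
  by apply: x_inj; rewrite !rmorphM /X /= !mmapX !mmap1U !ordfam_rank.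
rewrite /X -!mpolyXD => /(congr1 (fun p => p@_(U_(enum_rank c) + U_(enum_rank d)))) /eqP.
rewrite !mcoeffX eqxx; case: ((U_(enum_rank a) + U_(enum_rank b))%MM =P (U_(enum_rank c) + U_(enum_rank d))%MM) =>
  [/mnmP/(_ (enum_rank a)) + _|_]; last by rewrite eq_sym oner_eq0.
rewrite !mnmDE !mnm1E !(inj_eq enum_rank_inj) eqxx.
rewrite [d == a]eq_sym (negPf ad) addn0 [c == a]eq_sym.
by case: (a =P c) => //; rewrite addSn.
Qed.

End IndependentVariables.

(** * The two descents and their common field of invariants *)

Section Assembly.
Variables (G H K : finGroupType) (k : nat) (i0 : 'I_k).
Variables (pH : G -> H) (pK : G -> K) (pair : H -> K -> G).
Hypothesis pHM : forall g g', pH (g * g')%g = (pH g * pH g')%g.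
Hypothesis pKM : forall g g', pK (g * g')%g = (pK g * pK g')%g.
Hypothesis pH_pair : forall h k, pH (pair h k) = h.
Hypothesis pK_pair : forall h k, pK (pair h k) = k.
Hypothesis pairE : forall g, pair (pH g) (pK g) = g.
Variables (c d : int).
Hypothesis bezout : c * #|K|%:Z + d * #|H|%:Z = 1.
Local Notation vars := (vars G H K k).
Local Notation toV := (@toV G H K k pH pK).
Local Notation deg := (@deg G H K k pH pK pair c d).

Variables (F W : fieldType) (e : {rmorphism F -> W}) (x : vars -> W).
Hypothesis charF : [pchar F] =i pred0.
Hypothesis x_inj : injective (mmap e (ordfam x)).
Variable act : G -> {rmorphism W -> W}.
Hypothesis act1 : forall w, act 1%g w = w.
Hypothesis actM : forall g h w, act (g * h)%g w = act g (act h w).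
Hypothesis actC : forall g a, act g (e a) = e a.
Hypothesis actX : forall g v, act g (x v) = x (toV g v).
Variables (fG : {rmorphism gcp_field F G k -> W}) (fH : {rmorphism gcp_field F H k -> W}).
Variable fK : {rmorphism gcp_field F K k -> W}.
Hypothesis fGC : forall a, fG (ratfunC F _ a) = e a.
Hypothesis fHC : forall a, fH (ratfunC F _ a) = e a.
Hypothesis fKC : forall a, fK (ratfunC F _ a) = e a.
Hypothesis fGX : forall a b i, fG (gcp_var F a b i) = x (inl (inl (a, b, i))).
Hypothesis fHX : forall a b i, fH (gcp_var F a b i) = x (inr (inl (inl (a, b, i)))).
Hypothesis fKX : forall a b i, fK (gcp_var F a b i) = x (inr (inl (inr (a, b, i)))).

Let x0 : forall v, x v != 0 := indep_neq0 x_inj.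

Lemma fG_act g w : act g (fG w) = fG (gcp_act F k g w).
Proof.
move: w; apply: (@rvar_rmorph_ext F _ _ (act g \o fG) (fG \o gcp_act F k g)) => [a|[[a b] i]].
  change (act g (fG (ratfunC F _ a)) = fG (gcp_act F k g (ratfunC F _ a))).
  by rewrite gcp_actC fGC actC.
change (act g (fG (rvar F (a, b, i))) = fG (gcp_act F k g (rvar F (a, b, i)))).
by rewrite -gcp_varE gcp_actX !fGX actX.
Qed.

Lemma fH_act g w : act g (fH w) = fH (gcp_act F k (pH g) w).
Proof.
move: w; apply: (@rvar_rmorph_ext F _ _ (act g \o fH) (fH \o gcp_act F k (pH g))) => [a|[[a b] i]].
  change (act g (fH (ratfunC F _ a)) = fH (gcp_act F k (pH g) (ratfunC F _ a))).
  by rewrite gcp_actC fHC actC.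
change (act g (fH (rvar F (a, b, i))) = fH (gcp_act F k (pH g) (rvar F (a, b, i)))).
by rewrite -gcp_varE gcp_actX !fHX actX.
Qed.

Lemma fK_act g w : act g (fK w) = fK (gcp_act F k (pK g) w).
Proof.
move: w; apply: (@rvar_rmorph_ext F _ _ (act g \o fK) (fK \o gcp_act F k (pK g))) => [a|[[a b] i]].
  change (act g (fK (ratfunC F _ a)) = fK (gcp_act F k (pK g) (ratfunC F _ a))).
  by rewrite gcp_actC fKC actC.
change (act g (fK (rvar F (a, b, i))) = fK (gcp_act F k (pK g) (rvar F (a, b, i)))).
by rewrite -gcp_varE gcp_actX !fKX actX.
Qed.

Definition zG : {rmorphism gcpZ F G k -> W} := fG \o @gcpZ_entry F G k.
Definition zH : {rmorphism gcpZ F H k -> W} := fH \o @gcpZ_entry F H k.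
Definition zK : {rmorphism gcpZ F K k -> W} := fK \o @gcpZ_entry F K k.

Lemma zGC a : zG (gcpZ_const F G k a) = e a.
Proof. by rewrite -fGC -gcpZ_entryC. Qed.

Lemma zHC a : zH (gcpZ_const F H k a) = e a.
Proof. by rewrite -fHC -gcpZ_entryC. Qed.

Lemma zKC a : zK (gcpZ_const F K k a) = e a.
Proof. by rewrite -fKC -gcpZ_entryC. Qed.

Lemma rng_zG w : (w \in rng zG) =
  (w \in degree0 e (x \o inl) (deg \o inl)) && (w \in fixed act).
Proof.
rewrite (degree0_inl i0 pH_pair pK_pair bezout x0 fGC fGX).
apply/rngP/andP => [[A <-]|[/rimgP[v vL <-] /fixedP vf]].
  have := mem_rng (@gcpZ_entry F G k) A; rewrite (rng_gcpZ_entry i0) => /andP[AL /fixedP Af].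
  split; first exact: mem_rimg.
  by apply/fixedP => g; rewrite /zG [LHS]fG_act Af.
have : v \in rng (@gcpZ_entry F G k).
  rewrite (rng_gcpZ_entry i0) vL; apply/fixedP => g; apply: (fmorph_inj fG).
  by rewrite -fG_act vf.
by move=> /rngP[A EA]; exists A; rewrite -EA.
Qed.

Lemma zH_sub : {subset rng zH <= rimg fH (@loopfield F H k i0)}.
Proof.
move=> _ /rngP[A <-]; apply: mem_rimg.
by have := mem_rng (@gcpZ_entry F H k) A; rewrite (rng_gcpZ_entry i0) => /andP[].
Qed.

Lemma zK_sub : {subset rng zK <= rimg fK (@loopfield F K k i0)}.
Proof.
move=> _ /rngP[A <-]; apply: mem_rimg.
by have := mem_rng (@gcpZ_entry F K k) A; rewrite (rng_gcpZ_entry i0) => /andP[].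
Qed.

Lemma zH_fixed : {subset rng zH <= fixed act}.
Proof.
move=> _ /rngP[A <-]; apply/fixedP => g; rewrite /zH [LHS]fH_act.
have := mem_rng (@gcpZ_entry F H k) A; rewrite (rng_gcpZ_entry i0) => /andP[_ /fixedP Af].
by rewrite Af.
Qed.

Lemma zK_fixed : {subset rng zK <= fixed act}.
Proof.
move=> _ /rngP[A <-]; apply/fixedP => g; rewrite /zK [LHS]fK_act.
have := mem_rng (@gcpZ_entry F K k) A; rewrite (rng_gcpZ_entry i0) => /andP[_ /fixedP Af].
by rewrite Af.
Qed.

Lemma trace_entry (A : finGroupType) w : w \in @loopfield F A k i0 ->
  exists B, gcpZ_entry B = \sum_g gcp_act F k g w.
Proof.
move=> wL; apply/rngP; rewrite (rng_gcpZ_entry i0); apply/andP; split.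
  by apply: rpred_sum => g _; apply: loopfield_act.
by apply: sum_act_fixed; apply: gcp_actM.
Qed.

(** As G is H x K, acting on the two factors through its projections, the trace of the product
    splits into the trace over H times the trace over K. *)
Lemma trace_compos a b :
  a \in rimg fH (@loopfield F H k i0) -> b \in rimg fK (@loopfield F K k i0) ->
  \sum_g act g a * act g b \in compos zH zK.
Proof.
move=> /rimgP[v vL <-] /rimgP[w wL <-].
have -> : \sum_g act g (fH v) * act g (fK w) =
    fH (\sum_h gcp_act F k h v) * fK (\sum_l gcp_act F k l w).
  rewrite (reindex (fun hl => pair hl.1 hl.2)) /=; last first.
    exists (fun g => (pH g, pK g)) => [[h l] _|g _] /=; last exact: pairE.
    by rewrite pH_pair pK_pair.
  rewrite -(pair_bigA _ (fun h l => act (pair h l) (fH v) * act (pair h l) (fK w))) /=.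
  rewrite !rmorph_sum mulr_suml; apply: eq_bigr => h _.
  rewrite mulr_sumr; apply: eq_bigr => l _.
  by rewrite fH_act fK_act pH_pair pK_pair.
have [A <-] := trace_entry vL; have [B <-] := trace_entry wL.
exact: (compos_prod zH zK A B).
Qed.

Lemma fracs_compos w : (w \in fracs (compos zH zK)) =
  (w \in degree0 e (x \o inr) (deg \o inr)) && (w \in fixed act).
Proof.
have G0 : #|G|%:R != 0 :> gcpZ F H k.
  rewrite -(rmorph_nat (gcpZ_const F H k)) fmorph_eq0.
  move/pcharf0P: charF => ->; rewrite -lt0n; apply/card_gt0P; by exists 1%g.
apply: (fixed_fgen_sumprods act1 actM _ _ G0 trace_compos
          (M := degree0 e (x \o inr) (deg \o inr))).
- move=> g _ /rimgP[v vL <-]; rewrite fH_act; apply: mem_rimg; exact: loopfield_act.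
- move=> g _ /rimgP[v vL <-]; rewrite fK_act; apply: mem_rimg; exact: loopfield_act.
- exact: loopfieldH_degree0.
- exact: loopfieldK_degree0.
- apply: (degree0_inr x0 fHC fHX fKX) => v vS; apply: mem_fgen; [left|right]; exact: vS.
- exact: zH_sub.
- exact: zK_sub.
- exact: zH_fixed.
- exact: zK_fixed.
Qed.

(** The variables of K are independent over the field generated by those of H, which contains the
    image of F(H). *)
Lemma zHK_disjoint n (a : 'I_n -> gcpZ F H k) (b : 'I_n -> gcpZ F K k) :
  \sum_i zH (a i) * zK (b i) = 0 -> (exists i, a i != 0) ->
  exists2 c : 'I_n -> F, (exists i, c i != 0) & \sum_i gcpZ_const F K k (c i) * b i = 0.
Proof.
move=> ab0 [i ai0].
pose s (v : (H * H * 'I_k) + (K * K * 'I_k)) : vars := inr (inl v).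
have s_inj : injective s by move=> v w [].
have xs_inj : injective (mmap e (ordfam (x \o s))) by apply: subfamily_indep.
have y_indep := split_indep xs_inj; set S := fgen _ in y_indep.
have zHS w : fH w \in S.
  apply: (@ratfun_image F W _ fH S) => [c'|[[h h'] j]].
    by rewrite fHC; apply: mem_fgen; left; apply: mem_rng.
  by rewrite -gcp_varE fHX; apply: mem_fgen; right; exists (h, h', j).
have [||||c' c0 cb0] := @ratfun_linear_disjoint F W e _ _ S fK n
    (fun i => zH (a i)) (fun i => gcpZ_entry (b i)) fKC _ _ y_indep _ ab0.
- by case=> [[l l'] j]; rewrite -gcp_varE fKX.
- by move=> c'; apply: mem_fgen; left; apply: mem_rng.
- by move=> j; apply: zHS.
- by exists i; rewrite fmorph_eq0.
exists c' => //; apply: (fmorph_inj (@gcpZ_entry F K k)).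
rewrite rmorph0 -[RHS]cb0 rmorph_sum; apply: eq_bigr => j _.
by rewrite rmorphM -gcpZ_entryC.
Qed.

Let dact g := dact (@toD G H K pH pK) g.

Let deg_act g v : dact g (deg v) = deg (toV g v).
Proof. exact: (deg_act pHM pKM pH_pair pK_pair pairE). Qed.

Let e2 := frac_lift (@comps_incl_inj _ _ _ zH zK).

Lemma descent_G : exists phi : {rmorphism ratfun (gcpZ F G k) #|{: hkvars G H K k}| -> W},
  (forall A, phi (ratfunC _ _ A) = zG A) /\
  forall w, (exists y, phi y = w) <-> w \in degree0 e x deg /\ w \in fixed act.
Proof.
(* A loop edge has degree 0, and G moves this one freely. *)
pose theta := x (inl (inl (1%g, 1%g, i0))).
apply: (@monomial_descent F W e G act act1 actM actC vars x _ deg x_inj toV dact actX deg_act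
  (gvars G H K k) (hkvars G H K k) id _ _ _ _ _ theta) => //.
- by move=> v; exists v.
- by move=> g [[[a b] i]|[h|l]]; eexists.
- by move=> g [[[[a b] i]|[[a b] i]]|[u|a]]; eexists.
- move=> v; exact: (spanned_inr i0 pH_pair pK_pair bezout x v).
- apply: mem_fgen; right.
  rewrite -[0](subrr (potential pH pK c d 1%g)).
  exact: (wmonX (x \o inl) (deg \o inl) (inl (1%g, 1%g, i0))).
- move=> g; rewrite /theta actX => /(indep_inj x_inj) /= [].
  by rewrite mulg1.
- exact: rng_zG.
Qed.

Lemma descent_HK : exists phi : {rmorphism ratfun {fraction (comps zH zK)} #|{: gvars G H K k}| -> W},
  (forall A, phi (ratfunC _ _ A) = e2 A) /\
  forall w, (exists y, phi y = w) <-> w \in degree0 e x deg /\ w \in fixed act.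
Proof.
(* Each loop edge sees only one projection of g, so the product of both is needed for a trivial
   stabilizer. *)
pose thetaH := x (inr (inl (inl (1%g, 1%g, i0)))).
pose thetaK := x (inr (inl (inr (1%g, 1%g, i0)))).
pose swap (v : hkvars G H K k + gvars G H K k) : vars :=
  match v with inl j => inr j | inr i => inl i end.
apply: (@monomial_descent F W e G act act1 actM actC vars x _ deg x_inj toV dact actX deg_act
  (hkvars G H K k) (gvars G H K k) swap _ _ _ _ _ (thetaH * thetaK)).
- by move=> [v|v] [w|w] // [->].
- by move=> [v|v]; [exists (inr v) | exists (inl v)].
- by move=> g [[[[a b] i]|[[a b] i]]|[u|a]]; eexists.
- by move=> g [[[a b] i]|[h|l]]; eexists.
- move=> v; exact: (spanned_inl i0 pH pK pair c d x v).
- apply: mem_fgen; right; rewrite -[0]addr0.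
  apply: wmonM.
    rewrite -[0](subrr (delta (inl (inl 1%g) : weights G H K))).
    exact: (wmonX (x \o inr) (deg \o inr) (inl (inl (1%g, 1%g, i0)))).
  rewrite -[0](subrr (delta (inl (inr 1%g) : weights G H K))).
  exact: (wmonX (x \o inr) (deg \o inr) (inl (inr (1%g, 1%g, i0)))).
- move=> g; rewrite rmorphM !actX => E.
  have := indep_mul_inj x_inj E; rewrite mulrC [RHS]mulrC in E; have := indep_mul_inj x_inj E.
  move=> /= /(_ isT isT) [EK _] /(_ isT isT) [EH _].
  rewrite -[g]pairE; rewrite !mulg1 in EK EH; rewrite EK EH.
  by rewrite -[RHS]pairE (pH1 pHM) (pK1 pKM).
- by move=> w; rewrite rng_comps_frac fracs_compos.
Qed.

(** Both descents have the same image M^G, so the two rational function fields are identified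
    through it. *)
Lemma assembly : stably_isomorphic (gcpZ_const F G k) (@tofrac (comps zH zK) \o compsC zK zHC).
Proof.
have [phi1 [phi1C phi1E]] := descent_G; have [phi2 [phi2C phi2E]] := descent_HK.
have [|phi [phi_bij phiE]] := @same_image_iso _ _ _ phi1 phi2.
  by move=> w; rewrite phi1E phi2E.
exists #|{: hkvars G H K k}|, #|{: gvars G H K k}|, phi; split=> // a.
apply: (fmorph_inj phi2); rewrite phiE phi1C phi2C zGC.
rewrite /e2 frac_liftE.
by [].
Qed.

End Assembly.

Lemma isog_prod_projections (G H K : finGroupType) :
  [set: G] \isog [set: (H * K)%type] ->
  exists (pH : G -> H) (pK : G -> K) (pair : H -> K -> G),
    [/\ forall g g', pH (g * g')%g = (pH g * pH g')%g,
        forall g g', pK (g * g')%g = (pK g * pK g')%g,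
        forall h l, pH (pair h l) = h,
        forall h l, pK (pair h l) = l
      & forall g, pair (pH g) (pK g) = g].
Proof.
move=> /isogP[f f_inj f_im].
have fM g g' : f (g * g')%g = (f g * f g')%g by rewrite morphM ?inE.
have f_inj' : injective f by move=> g g' E; apply: (injmP f_inj); rewrite ?inE.
have /choice[h hE] (hl : H * K) : exists g, f g = hl.
  have : hl \in (f @* [set: G])%g by rewrite f_im inE.
  by case/morphimP => g _ _ ->; exists g.
exists (fun g => (f g).1), (fun g => (f g).2), (fun a b => h (a, b)); split.
- by move=> g g'; rewrite fM.
- by move=> g g'; rewrite fM.
- by move=> a b; rewrite hE.
- by move=> a b; rewrite hE.
- by move=> g; apply: f_inj'; rewrite hE; case: (f g).
Qed.

Lemma coprime_bezout (m n : nat) : coprime m n ->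
  exists c d : int, c * n%:Z + d * m%:Z = 1.
Proof.
move=> mn; have /coprimezP[[u v] /= uv] : coprimez n%:Z m%:Z by rewrite coprimezE coprime_sym.
by exists u, v.
Qed.

Theorem theorem1p3 (F : fieldType) (G H K : finGroupType) (k : nat)
    (isoG : [set: G] \isog [set: (H * K)%type])
    (copHK : coprime #|H| #|K|)
    (charF : [pchar F] =i pred0)
    (rootF : exists z : F, #|G|.-primitive_root z)
    (k_ge1 : (1 <= k)%N) :
  exists (T : idomainType) (iT : {rmorphism F -> T})
         (t : gcpZ F H k -> gcpZ F K k -> T),
    is_tensor_product (gcpZ_const F H k) (gcpZ_const F K k) iT t /\
    stably_isomorphic (gcpZ_const F G k) (@tofrac T \o iT).
Proof.
have [pH [pK [pair [pHM pKM pH_pair pK_pair pairE]]]] := isog_prod_projections isoG.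
have [c [d bezout]] := coprime_bezout copHK.
pose i0 := Ordinal k_ge1.
(* The generic fields of G, H and K embed in the rational function field in [vars] by renaming
   variables. *)
have jG_inj : injective (fun t : G * G * 'I_k => inl (inl t) : vars G H K k) by move=> u v [].
have jH_inj : injective (fun t : H * H * 'I_k => inr (inl (inl t)) : vars G H K k) by move=> u v [].
have jK_inj : injective (fun t : K * K * 'I_k => inr (inl (inr t)) : vars G H K k) by move=> u v [].
pose act := rvact F (@toV1 G H K k pH pK pHM pKM) (@toVM G H K k pH pK pHM pKM).
have actX g v : act g (rvar F v) = rvar F (toV pH pK g v) by apply: rinclX.
have fGX a b i : rincl F jG_inj (gcp_var F a b i) = rvar F (inl (inl (a, b, i)) : vars G H K k).
  by rewrite gcp_varE; apply: rinclX.
have fHX a b i : rincl F jH_inj (gcp_var F a b i) = rvar F (inr (inl (inl (a, b, i))) : vars G H K k).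
  by rewrite gcp_varE; apply: rinclX.
have fKX a b i : rincl F jK_inj (gcp_var F a b i) = rvar F (inr (inl (inr (a, b, i))) : vars G H K k).
  by rewrite gcp_varE; apply: rinclX.
have x_inj : injective (mmap (ratfunC F _) (ordfam (@rvar F (vars G H K k)))) by apply: ratfunX_indep.
have actC g a : act g (ratfunC F _ a) = ratfunC F _ a by apply: rinclC.
have act1 w : act 1%g w = w by apply: rvact1.
have actM g g' w : act (g * g')%g w = act g (act g' w) by apply: rvactM.
have fGC := @rinclC F _ _ _ jG_inj; have fHC := @rinclC F _ _ _ jH_inj.
have fKC := @rinclC F _ _ _ jK_inj.
exists (comps (zH (rincl F jH_inj)) (zK (rincl F jK_inj))), (compsC _ (zHC fHC)), (@comps_mk _ _ _ _ _).
split.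
  apply: comps_tensor; first exact: (zKC fKC).
  move=> n a b.
  exact: (zHK_disjoint x_inj fHC fKC fHX fKX).
exact: (assembly i0 pHM pKM pH_pair pK_pair pairE bezout charF x_inj act1 actM actC actX
  fGC fHC fKC fGX fHX fKX).
Qed.
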